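(* Let $R$ be a ring and let $\mathbf{K}=(R\text{-Mod},\subseteq_R)$ be the class of left $R$-modules with embeddings. The following are equivalent. (1) $R$ is left noetherian. (2) $\mathbf{K}$ is superstable. (3) For every cardinal $\lambda\ge |R|+\aleph_0$ there is a cardinal $\chi\ge\lambda$ such that $\mathbf{K}$ has uniqueness of limit models of cardinality $\chi$. (4) For every cardinal $\lambda\ge |R|+\aleph_0$, $\mathbf{K}$ has uniqueness of limit models of cardinality $\lambda$. (5) For every cardinal $\lambda\ge (|R|+\aleph_0)^+$, $\mathbf{K}$ has a superlimit of cardinality $\lambda$. (6) For every cardinal $\lambda\ge |R|+\aleph_0$, $\mathbf{K}$ is $\lambda$-stable. (7) Every limit model in $\mathbf{K}$ is $\Sigma$-injective.
   Context: All rings are associative with identity. $(R\text{-Mod},\subseteq_R)$ is the class of left $R$-modules ordered by the submodule relation; a $\mathbf{K}$-embedding $f:M\to N$ is an injective module homomorphism. For a class $\mathbf{K}$ with order $\le_{\mathbf K}$ and $\mathbf K$-embeddings: $\mathbf K_\lambda$ is the class of members of cardinality $\lambda$. Galois types: for $M\le_{\mathbf K}N$ and $b\in N$, $\mathbf{gtp}(b/M;N)$ is the class of $(b,M,N)$ under the transitive closure of the relation $(b_1,M,N_1)E_{at}(b_2,M,N_2)$ iff there exist $N^*\in\mathbf K$ and $\mathbf K$-embeddings $f_\ell:N_\ell\to N^*$ fixing $M$ pointwise with $f_1(b_1)=f_2(b_2)$; $\mathbf{gS}(M)$ is the set of all $\mathbf{gtp}(b/M;N)$ with $M\le_{\mathbf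 K}N\in\mathbf K$, $b\in N$. $\mathbf K$ is $\lambda$-stable if $|\mathbf{gS}(M)|\le\lambda$ for every $M\in\mathbf K_\lambda$. $M$ is universal over $N$ if $N\le_{\mathbf K}M$, $\|M\|=\|N\|=\lambda$, and every $N^*\in\mathbf K_\lambda$ with $N\le_{\mathbf K}N^*$ admits a $\mathbf K$-embedding $N^*\to M$ fixing $N$ pointwise. For a limit ordinal $\alpha<\lambda^+$, $M$ is a $(\lambda,\alpha)$-limit model if there is an increasing continuous chain $(M_i)_{i<\alpha}$ in $\mathbf K_\lambda$ with $M_{i+1}$ universal over $M_i$ for all $i$ and $M=\bigcup_{i<\alpha}M_i$; a limit model of cardinality $\lambda$ is a $(\lambda,\alpha)$-limit model for some such $\alpha$; a limit model is a limit model of some cardinality. $\mathbf K$ has uniqueness of limit models of cardinality $\lambda$ if there is a limit model of cardinality $\lambda$ and any two limit models of cardinality $\lambda$ are isomorphic. $\mathbf K$ is superstable if there is a cardinal $\mu$ such that $\mathbf K$ has uniqueness of limit models of cardinality $\lambda$ for every $\lambda\ge\mu$. $M$ is a superlimit of cardinality $\lambda$ if $M\in\mathbf K_\lambda$; every $N\in\mathbf K_\lambda$ admits a $\mathbf K$-embedding $f:N\to M$ with $f[N]\ne M$; and for every ordinal $\delta<\lambda^+$ and every increasing chain $(M_i)_{i<\delta}$ in $\mathbf K_\lambda$ with each $M_i\cong M$, $\bigcup_{i<\delta}M_i\cong M$. A module $M$ is $\Sigma$-injective if $M^{(I)}$ is injective for every index set $I$.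
   Formalization: R is assumed nonzero (for the zero ring (1) holds but (2) and (4) fail), and in (7) limit models are those of cardinality λ ≥ |R|+ℵ₀ (for smaller λ, (1)⇒(7) fails, e.g. R = Q[[x]][d/dx], λ = ℵ₀). *)

(* Defs.v *)
From HB Require Import structures.
From mathcomp Require Import all_boot all_algebra.
From mathcomp Require Import boolp classical_sets functions cardinality wochoice.
From Stdlib Require Import Relation_Operators.

Set Implicit Arguments.
Unset Strict Implicit.
Unset Printing Implicit Defensive.

Import GRing.Theory.

Local Open Scope ring_scope.
Local Open Scope classical_set_scope.
Local Open Scope card_scope.

(* Cardinals are represented by types, up to equipotence, in one fixed universe
   which also contains the rings, the modules, the index sets of direct sums
   and the index types of chains. *)
Definition cardinal := Type.

Definition cardinal_le (K L : cardinal) : Prop := [set: K] #<= [set: L].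

(* L >= K^+, that is, L > K *)
Definition cardinal_succ_le (K L : cardinal) : Prop :=
  cardinal_le K L /\ ~ cardinal_le L K.

(* |R| + aleph_0 *)
Definition LS (R : nzRingType) : cardinal := (R + nat)%type.

Section Submodule.
Variables (R : nzRingType) (V : lmodType R) (S : submodClosed V).

Record submod := Submod { submod_val : V; _ : submod_val \in S }.

HB.instance Definition _ := [isSub for submod_val].
HB.instance Definition _ := [Choice of submod by <:].
HB.instance Definition _ := [SubChoice_isSubLmodule of submod by <:].

End Submodule.

Section DirectSum.
Variables (R : nzRingType) (I : cardinal) (M : lmodType R).

Definition finite_support : {pred I -> M} :=
  fun f => `[< finite_set [set i | f i <> 0] >].

Fact finite_support_submod_closed : submod_closed finite_support.
Proof.
split=> [|a f g /asboolP ff /asboolP fg]; apply/asboolP.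
  by apply: (sub_finite_set _ (finite_set0 I)) => i /=.
have ffg := conj ff fg; rewrite -finite_setU in ffg.
apply: sub_finite_set ffg => i /= fgi.
have [fi0|] := pselect (f i = 0); last by left.
right=> gi0; apply: fgi.
by rewrite /GRing.add /= /GRing.scale /= fi0 gi0 scaler0 addr0.
Qed.

HB.instance Definition _ :=
  GRing.isSubmodClosed.Build R (I -> M) finite_support finite_support_submod_closed.

Definition direct_sum : lmodType R := submod finite_support.

End DirectSum.

Section Modules.
Variable R : nzRingType.
Implicit Types (L : cardinal) (M N : lmodType R).

Definition left_noetherian : Prop :=
  forall J : nat -> submodClosed R^o,
    (forall n, {subset J n <= J n.+1}) ->
    exists n, forall m, (n <= m)%N -> J m =i J n.

Definition injective_module M : Prop :=
  forall (A B : lmodType R) (i : {linear A -> B}) (f : {linear A -> M}),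
    injective i -> exists g : {linear B -> M}, forall x, g (i x) = f x.

Definition sigma_injective M : Prop :=
  forall I : cardinal, injective_module (direct_sum I M).

Definition module_iso M N : Prop :=
  exists f : {linear M -> N}, bijective f.

Definition card_of M : cardinal := M.

Definition in_K L M : Prop := [set: card_of M] #= [set: L].

(* Galois types. An extension of M is given by an embedding of M, so that
   "fixing M pointwise" means commuting with the embeddings of M. *)
Record pretype M := Pretype {
  pt_mod : lmodType R;
  pt_emb : {linear M -> pt_mod};
  pt_emb_inj : injective pt_emb;
  pt_elt : pt_mod }.

Definition E_at M (p q : pretype M) : Prop :=
  exists (N : lmodType R)
         (f : {linear pt_mod p -> N}) (g : {linear pt_mod q -> N}),
    [/\ injective f, injective g,
        forall x, f (pt_emb p x) = g (pt_emb q x) &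
        f (pt_elt p) = g (pt_elt q)].

Definition gtp M (p : pretype M) : pretype M -> Prop :=
  fun q => clos_trans (pretype M) (@E_at M) p q.

(* gS M lives in a larger universe than the modules, out of reach of set and
   of the comparison of cardinals on sets *)
Definition gS M := {T : pretype M -> Prop | exists p, T = gtp p}.

Definition stable L : Prop :=
  forall M, in_K L M -> exists F : gS M -> L, injective F.

(* The submodule B of V is universal over the submodule A; again an
   extension N of A is given by an embedding j of A. *)
Definition universal_over L (V : lmodType R) (A B : submodClosed V) : Prop :=
  [/\ {subset A <= B}, in_K L (submod A), in_K L (submod B) &
      forall (N : lmodType R) (j : {linear submod A -> N}),
        in_K L N -> injective j ->
        exists f : {linear N -> submod B},
          injective f /\ forall x, \val (f (j x)) = \val x].

Section Chains.
(* The index of a chain is an ordinal, given as a well-ordered type. *)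
Variables (I : cardinal) (le : rel I).

Definition ord_lt (i j : I) : Prop := le i j /\ i <> j.

Definition is_succ (i j : I) : Prop :=
  ord_lt i j /\ forall k, ord_lt i k -> le j k.

Definition is_limit (i : I) : Prop :=
  (exists j, ord_lt j i) /\ forall j, ord_lt j i -> exists2 k, ord_lt j k & ord_lt k i.

Definition limit_ordinal : Prop :=
  [/\ well_order le, exists i : I, True & forall i, exists j, ord_lt i j].

Definition increasing_chain L M (C : I -> submodClosed M) : Prop :=
  (forall i, in_K L (submod (C i))) /\
  (forall i j, le i j -> {subset C i <= C j}).

Definition continuous_chain M (C : I -> submodClosed M) : Prop :=
  forall i, is_limit i -> forall x, x \in C i -> exists2 j, ord_lt j i & x \in C j.

Definition chain_union M (C : I -> submodClosed M) : Prop :=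
  forall x, exists i, x \in C i.

(* M is a (L, I)-limit model; |I| <= L says that the ordinal is below L^+ *)
Definition limit_model_at L M : Prop :=
  [/\ limit_ordinal, cardinal_le I L &
      exists C : I -> submodClosed M,
        [/\ increasing_chain L C, continuous_chain C,
            forall i j, is_succ i j -> universal_over L (C i) (C j) &
            chain_union C]].

End Chains.

Definition limit_model L M : Prop :=
  exists (I : cardinal) (le : rel I), limit_model_at le L M.

(* As usual for abstract elementary classes, limit models are only considered
   in cardinalities at least LS R. Below LS R a limit model over a left
   noetherian ring need not even be injective: for R = Q[[x]]<d/dx>, the
   countable modules are the direct sums of copies of the simple module R/Rx,
   and the countably infinite sum, which is a limit model of cardinality
   aleph_0, is not injective because of the essential extension R/Rx(d/dx)
   of R/Rx. *)
Definition is_limit_model M : Prop :=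
  exists L, cardinal_le (LS R) L /\ limit_model L M.

Definition uniqueness_of_limit_models L : Prop :=
  (exists M, limit_model L M) /\
  (forall M N, limit_model L M -> limit_model L N -> module_iso M N).

Definition superstable : Prop :=
  exists mu : cardinal, forall L,
    cardinal_le mu L -> uniqueness_of_limit_models L.

(* In the last clause the empty chain is excluded by chain_union, since a
   module is nonempty. *)
Definition superlimit L M : Prop :=
  [/\ in_K L M,
      forall N, in_K L N ->
        exists f : {linear N -> M}, injective f /\ range f <> [set: M] &
      forall (I : cardinal) (le : rel I) (N : lmodType R)
             (C : I -> submodClosed N),
        well_order le -> cardinal_le I L ->
        increasing_chain le L C ->
        (forall i, module_iso (submod (C i)) M) ->
        chain_union C -> module_iso N M].

End Modules.

(* Main.v *)
(* Over a noetherian ring a limit model is injective, because a homomorphism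
   from a (finitely generated) left ideal into the union of the chain has its
   image in one member, where the next universal member solves it. All modules
   of the cardinality embed in it, so limit models of one cardinality embed in
   each other and Bumby's Schroeder-Bernstein theorem for injectives makes them
   isomorphic. They exist because there is an injective module W of any
   cardinality T >= LS R containing all modules of cardinality at most T: if A
   embeds in an injective E, then E x W is universal over A.

   Conversely, over any ring, unions of universal chains whose length is the
   successor cardinal of LS R are injective, whereas the injectivity of the union
   of a universal chain of length omega forces R to be noetherian. Uniqueness of
   limit models, like the existence of a superlimit, identifies the two unions.

   A Galois type over M amounts to a left ideal J and a homomorphism J -> M.
   Finitely generated ideals allow few of them; an ascending chain of ideals
   gives T ^ nat of them over some M of cardinality T, and some T < T ^ nat.

   Partial homomorphisms are represented throughout by their graphs. *)

Require Import Defs.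
From HB Require Import structures.
From mathcomp Require Import all_boot all_order all_algebra.
From mathcomp Require Import boolp classical_sets functions cardinality wochoice.
From Stdlib Require Import Relation_Operators.

Set Implicit Arguments.
Unset Strict Implicit.
Unset Printing Implicit Defensive.

Import GRing.Theory.

Local Open Scope ring_scope.
Local Open Scope classical_set_scope.
Local Open Scope card_scope.

(** * Cardinal arithmetic *)

(** Over a general ring, an injective module containing a given module of cardinality T may have to
    be larger than T, because there can be too many left ideals and too many maps from them. The
    converse therefore starts from 2 ^ LS R, where [coded] holds over any ring and into which the
    successor cardinal of LS R embeds. For a superlimit they are arranged to be isomorphic to it.
    One chain construction, with a predicate [Phi] on the successor members, serves both cases.
    Noetherianity also shortens Bumby's argument: a countable direct sum of injectives is itself
    injective, so no injective hull is taken. *)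

Section ZornAbove.
Variables (T : Type) (P : set (set T)) (X0 : set T).

(** Zorn's lemma is applied to the sets whose union with [X0] satisfies [P]; the empty chain then
    costs only [P X0]. *)
Lemma zorn_above :
    P X0 ->
    (forall F : set (set T), F !=set0 -> F `<=` P -> total_on F subset ->
      P (\bigcup_(X in F) X)) ->
  exists A, [/\ P A, X0 `<=` A & forall B, A `<=` B -> P B -> B `<=` A].
Proof.
move=> P0 PU; have [F FP Ftot|A [PA Amax]] := @Zorn_bigcup T [set X | P (X0 `|` X)].
  have [F0|/set0P/negP/negPn/eqP->] := pselect (F !=set0); last first.
    by rewrite /= bigcup_set0 setU0.
  rewrite /=; have -> : X0 `|` \bigcup_(X in F) X = \bigcup_(X in [set X0 `|` X | X in F]) X.
    apply/seteqP; split=> x.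
      case: F0 => X FX [x0|[Y FY Yx]]; first by exists (X0 `|` X); [exists X|left].
      by exists (X0 `|` Y); [exists Y|right].
    by move=> [_ [X FX <-]] [|Xx]; [left|right; exists X].
  apply: PU.
  - by case: F0 => X FX; exists (X0 `|` X), X.
  - by move=> _ [X FX <-]; apply: FP.
  - move=> _ _ [X FX <-] [Y FY <-].
    by have [XY|YX] := Ftot _ _ FX FY; [left|right]; apply: setUS.
exists (X0 `|` A); split=> // B AB PB b Bb; right; apply: contrapT => nAb.
apply: (Amax B); last first.
  rewrite /=; have -> // : X0 `|` B = B.
  by apply/seteqP; split=> x; [case=> // Xx; apply: AB; left|right].
by split=> [x Ax|BA]; [apply: AB; right|exact/nAb/BA].
Qed.

End ZornAbove.

Lemma sval_inj T (P : T -> Prop) : injective (@sval T P).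
Proof. by move=> [x Px] [y Py] /= exy; apply: eq_exist. Qed.

Lemma existT_injr T (P : T -> Type) a (x y : P a) : existT P a x = existT P a y -> x = y.
Proof. by move=> e; have := projT2_eq e; rewrite (Prop_irrelevance (projT1_eq e) erefl). Qed.

Definition embeds (T U : Type) : Prop := exists f : T -> U, injective f.

Lemma embeds_refl T : embeds T T. Proof. by exists id. Qed.

Lemma embeds_trans U T V : embeds T U -> embeds U V -> embeds T V.
Proof. by move=> [f fi] [g gi]; exists (g \o f); apply: inj_comp. Qed.

Lemma embeds_surj T U (f : T -> U) : (forall u, exists t, f t = u) -> embeds U T.
Proof.
move=> /choice[g gK]; exists g => u v guv.
by rewrite -[u]gK guv gK.
Qed.

Lemma cardinal_leP K L : cardinal_le K L <-> embeds K L.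
Proof.
split=> [/card_leP[f]|[f fi]].
  exists (fun x => val (f (to_setT x))) => x y /val_inj.
  by move=> /(inj (mem_set I) (mem_set I))/(congr1 val).
have fI : {in [set: K] &, injective f} by move=> ? ? _ _; apply: fi.
by rewrite /cardinal_le -(card_le_eql (inj_card_eq fI)) subset_card_le.
Qed.

Lemma card_eqTP K L : ([set: K] #= [set: L]) <-> embeds K L /\ embeds L K.
Proof.
rewrite card_eq_le; split=> [/andP[/cardinal_leP ? /cardinal_leP]//|].
by move=> [/cardinal_leP ? /cardinal_leP ?]; apply/andP.
Qed.

(** A maximal partial injection is total on one side, since otherwise a pair of missing points could
    be added. The equivalence in [P] says functional and injective at once. *)
Lemma embeds_total T U : embeds T U \/ embeds U T.
Proof.
pose P (G : set (T * U)) := forall x y x' y', G (x, y) -> G (x', y') ->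
  (x = x' <-> y = y').
have [|F _ FP Ftot|G [PG _ Gmax]] := @zorn_above _ P set0.
- by [].
- move=> x y x' y' [X FX Xxy] [Y FY Yxy].
  by have [XY|XY] := Ftot _ _ FX FY; [apply: (FP Y)|apply: (FP X)] => //; apply: XY.
have [dT|/existsNP[x ndx]] := pselect (forall x, exists y, G (x, y)).
  have [f fG] := choice dT; left; exists f => x x' fx.
  by apply/(PG _ _ _ _ (fG x) (fG x')).
have [dU|/existsNP[y ndy]] := pselect (forall y, exists x, G (x, y)).
  have [f fG] := choice dU; right; exists f => y y' fy.
  by apply/(PG _ _ _ _ (fG y) (fG y')).
have /Gmax sG : P (G `|` [set (x, y)]).
  move=> a b a' b' [Gab|[-> ->]] [Gab'|[-> ->]] //; first exact: PG Gab Gab'.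
  - by split=> e; [case: ndx; exists b|case: ndy; exists a]; rewrite -e.
  - by split=> e; [case: ndx; exists b'|case: ndy; exists a']; rewrite e.
by case: ndx; exists y; apply: sG; [left|right].
Qed.

Lemma embeds_prod A B C D : embeds A C -> embeds B D -> embeds (A * B) (C * D).
Proof.
move=> [f fi] [g gi]; exists (fun x => (f x.1, g x.2)) => -[a b] [a' b'] /= [].
by move=> /fi-> /gi->.
Qed.

(* A maximal injection A * A -> A with A infinite has a domain as large as T:
   otherwise T \ A contains a copy A' of A, and the injection extends to
   A :|: A' with values in A' outside A * A. *)
Lemma embeds_square T : embeds nat T -> embeds (T * T) T.
Proof.
(* A triple (x, y, z) means that the pair (x, y) is sent to z; the set A is read off the diagonal as
   [dom G]. *)
move=> [i iI]; pose dom (G : set (T * T * T)) x := exists z, G (x, x, z).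
pose P G := [/\ forall x y z, G (x, y, z) -> [/\ dom G x, dom G y & dom G z],
   forall x y, dom G x -> dom G y -> exists z, G (x, y, z),
   forall x y z z', G (x, y, z) -> G (x, y, z') -> z = z' &
   forall x y x' y' z, G (x, y, z) -> G (x', y', z) -> x = x' /\ y = y'].
have domS (F G : set (T * T * T)) x : F `<=` G -> dom F x -> dom G x.
  by move=> FG [z Fz]; exists z; apply: FG.
pose G0 : set (T * T * T) := [set (i x.1, i x.2, i (choice.pickle x)) | x in [set: nat * nat]].
have dG0 n : dom G0 (i n) by exists (i (choice.pickle (n, n))), (n, n).
have [|F F0 FP Ftot|G [[Gd Gt Gf Gi] G0G Gmax]] := @zorn_above _ P G0.
- split.
  + by move=> x y z [[a b] _ [<- <- <-]]; split; apply: dG0.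
  + move=> x y [_ [[a b] _ [<- _ _]]] [_ [[c d] _ [<- _ _]]].
    by exists (i (choice.pickle (a, c))), (a, c).
  + by move=> x y z z' [[a b] _ [<- <- <-]] [[c d] _ [/iI-> /iI-> <-]].
  + move=> x y x' y' z [[a b] _ [<- <- <-]] [[c d] _ [<- <- /iI]].
    by move=> /(pcan_inj choice.pickleK)[-> ->].
- have FU X : F X -> X `<=` \bigcup_(X in F) X by move=> FX x; exists X.
  have F2 x y : (\bigcup_(X in F) X) x -> (\bigcup_(X in F) X) y ->
      exists X, [/\ F X, X x & X y].
    move=> [X FX Xx] [Y FY Yy].
    by have [/(_ _ Xx)|/(_ _ Yy)] := Ftot _ _ FX FY => ?; [exists Y|exists X].
  split.
  + move=> x y z [X FX Xx]; have [/(_ _ _ _ Xx)[dx dy dz] _ _ _] := FP _ FX.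
    by split; apply: domS (FU _ FX) _.
  + move=> x y [u Ux] [v Uy]; have [X [FX Xx Xy]] := F2 _ _ Ux Uy.
    have [_ /(_ x y (ex_intro _ u Xx) (ex_intro _ v Xy))[z Xz] _ _] := FP _ FX.
    by exists z, X.
  + move=> x y z z' Uz Uz'; have [X [FX Xz Xz']] := F2 _ _ Uz Uz'.
    by have [_ _ Xf _] := FP _ FX; apply: Xf Xz Xz'.
  + move=> x y x' y' z Uz Uz'; have [X [FX Xz Xz']] := F2 _ _ Uz Uz'.
    by have [_ _ _ Xi] := FP _ FX; apply: Xi Xz Xz'.
have di n : dom G (i n) by apply: domS G0G _.
have [p pG] : exists p : T -> T -> T, forall x y, dom G x -> dom G y -> G (x, y, p x y).
  have /choice[p pG] (u : T * T) : exists z, dom G u.1 -> dom G u.2 -> G (u.1, u.2, z).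
    have [[d1 d2]|nd] := pselect (dom G u.1 /\ dom G u.2).
      by have [z Gz] := Gt _ _ d1 d2; exists z.
    by exists (i 0%N) => d1 d2; case: nd.
  by exists (fun x y => p (x, y)) => x y; apply: (pG (x, y)).
have dp x y : dom G x -> dom G y -> dom G (p x y).
  by move=> dx dy; have [] := Gd _ _ _ (pG _ _ dx dy).
have pI x y x' y' : dom G x -> dom G y -> dom G x' -> dom G y' ->
    p x y = p x' y' -> x = x' /\ y = y'.
  move=> dx dy dx' dy' pe; apply: (Gi _ _ _ _ (p x y)); first exact: pG.
  by rewrite pe; apply: pG.
(* If the complement of A embeds in A, then so does T, the tags [i 0] and [i 1] keeping the two
   parts apart, and [p] codes pairs from T. *)
have [[f fI]|[g gI]] := embeds_total {x | ~ dom G x} {x | dom G x}.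
  pose e x := match pselect (dom G x) with left _ => p (i 0%N) x
    | right nd => p (i 1%N) (sval (f (exist _ x nd))) end.
  have df x nd : dom G (sval (f (exist _ x nd))) by apply: svalP.
  have de x : dom G (e x) by rewrite /e; case: pselect => [d|nd]; apply: dp.
  have eI : injective e.
    move=> x y; rewrite /e; case: pselect => [dx|ndx]; case: pselect => [dy|ndy].
    - by move=> /pI[].
    - by move=> /pI[]// /iI.
    - by move=> /pI[]// /iI.
    - by move=> /pI[]// _ /sval_inj/fI/(congr1 sval).
  exists (fun u => p (e u.1) (e u.2)) => -[x y] [x' y'] /= /pI[]//.
  by move=> /eI-> /eI->.
pose g' x := if pselect (dom G x) is left d then sval (g (exist _ x d)) else x.
have ng' x : dom G x -> ~ dom G (g' x).
  by move=> dx; rewrite /g'; case: pselect => // d; case: (g _).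
have g'I x y : dom G x -> dom G y -> g' x = g' y -> x = y.
  rewrite /g'; case: pselect => // dx; case: pselect => // dy _ _.
  by move=> /sval_inj/gI/(congr1 sval).
pose s (u : bool) a := if u then g' a else a.
have sI u a v b : dom G a -> dom G b -> s u a = s v b -> u = v /\ a = b.
  move=> da db; case: u v => [] [] //=.
  - by move=> /g'I->.
  - by move=> e; case: (ng' a); rewrite ?e.
  - by move=> e; case: (ng' b); rewrite -?e.
(* The flags u, v tell which coordinates lie in A', at least one of them. The tag u + 2v, one of 1,
   2, 3, separates the three kinds of new pairs. *)
pose G' : set (T * T * T) := [set w | exists u v a b, [/\ u || v, dom G a, dom G b
  & w = (s u a, s v b, g' (p (i (u + v.*2)%N) (p a b)))]].
have dG'r u a : dom G a -> dom (G `|` G') (s u a).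
  case: u => /= da.
    by exists (g' (p (i 3%N) (p a a))); right; exists true, true, a, a.
  by exists (p a a); left; apply: pG.
have dG'l x : dom (G `|` G') x -> exists u a, dom G a /\ x = s u a.
  move=> [z [Gz|[u [v [a [b [_ da db [ex _ _]]]]]]]]; last by exists u, a.
  by exists false, x; split=> //; exists z.
have dip n a b : dom G a -> dom G b -> dom G (p (i n) (p a b)).
  by move=> da db; apply/dp/dp/db => //; apply: di.
have G'n x y z : G' (x, y, z) -> ~ dom G z.
  move=> [u [v [a [b [uv da db [_ _ ->]]]]]].
  by apply: ng'; apply: dip.
have /Gmax sG : P (G `|` G').
  split.
  - move=> x y z [/Gd[dx dy dz]|]; first by split; apply: (dG'r false).
    move=> [u [v [a [b [uv da db [-> -> ->]]]]]].
    by split; [exact: dG'r|exact: dG'r|apply: (dG'r true); exact: dip].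
  - move=> x y /dG'l[u [a [da ->]]] /dG'l[v [b [db ->]]].
    have [uv|] := boolP (u || v).
      by exists (g' (p (i (u + v.*2)%N) (p a b))); right; exists u, v, a, b.
    by case: u v => [] [] // _; exists (p a b); left; apply: pG.
  - move=> x y z z' [Gz|Gz] [Gz'|Gz'].
    + exact: Gf Gz Gz'.
    + have [dx dy _] := Gd _ _ _ Gz; move: Gz' => [u [v [a [b [uv da db [ex ey _]]]]]].
      move: uv; have [<- _] := sI false x u a dx da ex.
      by have [<- _] := sI false y v b dy db ey.
    + have [dx dy _] := Gd _ _ _ Gz'; move: Gz => [u [v [a [b [uv da db [ex ey _]]]]]].
      move: uv; have [<- _] := sI false x u a dx da ex.
      by have [<- _] := sI false y v b dy db ey.
    + move: Gz Gz' => [u [v [a [b [uv da db [-> -> ->]]]]]].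
      move=> [u' [v' [a' [b' [uv' da' db' [e1 e2 ->]]]]]].
      by have [-> ->] := sI _ _ _ _ da da' e1; have [-> ->] := sI _ _ _ _ db db' e2.
  - move=> x y x' y' z [Gz|Gz] [Gz'|Gz'].
    + exact: Gi Gz Gz'.
    + by case: (G'n _ _ _ Gz'); have [] := Gd _ _ _ Gz.
    + by case: (G'n _ _ _ Gz); have [] := Gd _ _ _ Gz'.
    + move: Gz Gz' => [u [v [a [b [uv da db [-> -> ->]]]]]].
      move=> [u' [v' [a' [b' [uv' da' db' [-> ->]]]]]].
      move=> /g'I /pI[]; try by [exact/dip|exact/di|exact/dp].
      by move=> /iI uve /pI[]// -> ->; move: uve; case: u v u' v' {uv uv'} => [] [] [] [].
case: (ng' (i 0%N) (di 0%N)); exists (g' (p (i 3%N) (p (i 0%N) (i 0%N)))).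
by apply: sG; [left|right; exists true, true, (i 0%N), (i 0%N)].
Qed.

Section Infinite.
Variable T : Type.
Hypothesis Tinf : embeds nat T.

Lemma embeds_inf_prod A B : embeds A T -> embeds B T -> embeds (A * B) T.
Proof.
by move=> AT BT; apply: embeds_trans (embeds_square Tinf); apply: embeds_prod.
Qed.

Lemma embeds_inf_sum A B : embeds A T -> embeds B T -> embeds (A + B) T.
Proof.
move=> [f fI] [g gI]; apply: embeds_trans (embeds_inf_prod Tinf (embeds_refl T)).
exists (fun x => match x with inl a => (0%N, f a) | inr b => (1%N, g b) end).
by move=> [a|b] [a'|b'] [] // => [/fI|/gI] ->.
Qed.

Lemma embeds_unit : embeds unit T.
Proof. by have [i iI] := Tinf; exists (fun=> i 0%N) => -[] []. Qed.

Lemma embeds_inf_option A : embeds A T -> embeds (option A) T.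
Proof.
move=> AT; apply: embeds_trans (embeds_inf_sum embeds_unit AT).
by exists (fun x => if x is Some a then inr a else inl tt) => -[a|] [b|] // [->].
Qed.

Lemma embeds_inf_seq A : embeds A T -> embeds (seq A) T.
Proof.
move=> AT; have [c cI] := embeds_inf_option (embeds_inf_prod AT (embeds_refl T)).
pose enc := fix enc s := if s is x :: s' then c (Some (x, enc s')) else c None.
exists enc; elim=> [|x s IHs] [|y t] //= /cI // [-> /IHs-> //].
Qed.

Lemma embeds_inf_sigT I (X : I -> Type) :
  embeds I T -> (forall i, embeds (X i) T) -> embeds {i & X i} T.
Proof.
move=> IT XT; apply: embeds_trans (embeds_inf_prod IT (embeds_refl T)).
pose f i := sval (cid (XT i)); have fI i : injective (f i) by apply: svalP.
exists (fun x => (projT1 x, f _ (projT2 x))) => -[i x] [j y] /= [eij].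
by case: _ / eij y => y /fI->.
Qed.

Lemma embeds_cover I U (S : I -> set U) :
    embeds I T -> (forall i, embeds {x | S i x} T) -> (forall x, exists i, S i x) ->
  embeds U T.
Proof.
move=> IT ST Scov; apply: embeds_trans (embeds_inf_sigT IT ST).
apply: (@embeds_surj _ _ (fun x => sval (projT2 x))) => x.
by have [i Six] := Scov x; exists (existT _ i (exist _ x Six)).
Qed.

End Infinite.

(** * Submodules, quotients and Baer's criterion *)

Section LinearMaps.
Variables (R : nzRingType) (A B : lmodType R) (f : A -> B).
Hypothesis f_linear : forall a x y, f (a *: x + y) = a *: f x + f y.

Definition linear_fun : A -> B := f.
HB.instance Definition _ := GRing.isLinear.Build R A B _ linear_fun f_linear.

(** Lets a proof turn a function shown to be linear on the spot into a linear map. *)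
Lemma linear_exists : exists g : {linear A -> B}, forall x, g x = f x.
Proof. by exists linear_fun. Qed.

End LinearMaps.

Lemma linear_comb (R : nzRingType) (A B : lmodType R) (f : {linear A -> B}) a x y :
  f (a *: x + y) = a *: f x + f y.
Proof. exact: linearP. Qed.

Lemma linear_scale (R : nzRingType) (A B : lmodType R) (f : {linear A -> B}) a x :
  f (a *: x) = a *: f x.
Proof. exact: linearZ. Qed.

Lemma linear_inj (R : nzRingType) (A B : lmodType R) (f : {linear A -> B}) :
  (forall x, f x = 0 -> x = 0) -> injective f.
Proof.
move=> f0 x y fxy; apply/eqP; rewrite -subr_eq0; apply/eqP/f0.
by rewrite linearB fxy subrr.
Qed.

Lemma inj_linear0 (R : nzRingType) (A B : lmodType R) (f : {linear A -> B}) x :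
  injective f -> f x = 0 -> x = 0.
Proof. by move=> fI fx; apply: fI; rewrite fx linear0. Qed.

Section SubmodSets.
Variables (R : nzRingType).
Implicit Types (V W : lmodType R).

Definition is_submod V (S : set V) : Prop :=
  S 0 /\ forall a x y, S x -> S y -> S (a *: x + y).

Lemma is_submodD V (S : set V) x y : is_submod S -> S x -> S y -> S (x + y).
Proof. by move=> [_ SP] Sx Sy; rewrite -[x]scale1r; apply: SP. Qed.

Lemma is_submodZ V (S : set V) a x : is_submod S -> S x -> S (a *: x).
Proof. by move=> [S0 SP] Sx; rewrite -[_ *: _]addr0; apply: SP. Qed.

Lemma is_submodN V (S : set V) x : is_submod S -> S x -> S (- x).
Proof. by move=> SS Sx; rewrite -scaleN1r; apply: is_submodZ. Qed.

Lemma is_submodB V (S : set V) x y : is_submod S -> S x -> S y -> S (x - y).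
Proof. by move=> SS Sx Sy; apply: is_submodD => //; apply: is_submodN. Qed.

Lemma is_submod_closed V (S : submodClosed V) : is_submod [set x | x \in S].
Proof.
split=> [|a x y xS yS]; rewrite /= ?rpred0//.
by rewrite rpredD// rpredZ.
Qed.

Section Pred.
Variables (V : lmodType R) (S : set V) (SS : is_submod S).

Definition submod_pred : {pred V} := fun x => `[< S x >].

Fact submod_pred_closed : submod_closed submod_pred.
Proof.
by split=> [|a x y /asboolP Sx /asboolP Sy]; apply/asboolP; case: SS => // _; apply.
Qed.
HB.instance Definition _ :=
  GRing.isSubmodClosed.Build R V submod_pred submod_pred_closed.

Definition submod_set : submodClosed V := submod_pred.

End Pred.

Lemma submod_valP V (S : submodClosed V) (x : submod S) : \val x \in S.
Proof. exact: valP. Qed.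

Lemma submod_val_linear V (S : submodClosed V) a (x y : submod S) :
  \val (a *: x + y) = a *: \val x + \val y.
Proof. by []. Qed.

Lemma submod_incl V (S : submodClosed V) :
  exists f : {linear submod S -> V}, forall x, f x = \val x.
Proof. exact: (@linear_exists R (submod S) V (fun x => \val x)). Qed.

Lemma submod_corestrict V W (f : {linear V -> W}) (S : submodClosed W) :
  (forall x, f x \in S) ->
  exists g : {linear V -> submod S}, forall x, \val (g x) = f x.
Proof.
move=> fS; pose g x : submod S := Submod (fS x).
have [|h hg] := @linear_exists R V (submod S) g.
  by move=> a x y; apply: val_inj; rewrite submod_val_linear /= linear_comb.
by exists h => x; rewrite hg.
Qed.

End SubmodSets.

Section Quotient.
Variables (R : nzRingType) (V : lmodType R) (S : set V).
Hypothesis SS : is_submod S.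

(** The quotient is carried by one representative of each coset. The result of [choose] does not
    depend on the starting point nor on the form of the predicate, so [rep] is constant on
    cosets. *)
Let rep (x : V) : V := choose (fun y => `[< S (y - x) >]) x.

Let repP x : S (rep x - x).
Proof.
apply/asboolP; rewrite /rep; apply: (@chooseP _ (fun y => `[< S (y - x) >])).
by apply/asboolP; rewrite subrr; case: SS.
Qed.

Let repE x y : rep x = rep y <-> S (x - y).
Proof.
split=> [e|Sxy].
  have -> : x - y = (rep y - y) - (rep x - x).
    by rewrite e opprB [RHS]addrC addrA subrK.
  by apply: is_submodB.
have SC u v : S (u - v) -> S (v - u) by move=> /is_submodN; rewrite opprB; apply.
have ST u v w : S (u - v) -> S (v - w) -> S (u - w).
  by move=> Su Sv; rewrite -(subrK v u) -addrA; apply: is_submodD.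
rewrite /rep (@eq_choose _ _ (fun z => `[< S (z - y) >])); last first.
  move=> z; apply/asbool_equiv_eq; split=> H; [exact: ST H Sxy|].
  exact: ST H (SC _ _ Sxy).
by apply: choose_id; apply/asboolP; rewrite ?subrr //; case: SS.
Qed.

Record quotient := Quotient { quotient_val : V; _ : rep quotient_val == quotient_val }.

HB.instance Definition _ := [isSub for quotient_val].
HB.instance Definition _ := [Choice of quotient by <:].

Let pi_proof x : rep (rep x) == rep x.
Proof. by apply/eqP/repE/repP. Qed.

Let pi x : quotient := Quotient (pi_proof x).

Let piE x y : pi x = pi y <-> S (x - y).
Proof.
rewrite -repE; split=> e; first exact: (congr1 quotient_val e).
by apply: val_inj.
Qed.

Let piK q : pi (quotient_val q) = q.
Proof. by apply: val_inj; case: q => x px; apply/eqP. Qed.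

Let qadd p q := pi (quotient_val p + quotient_val q).
Let qopp p := pi (- quotient_val p).
Let qscale a p := pi (a *: quotient_val p).

Let qaddE x y : qadd (pi x) (pi y) = pi (x + y).
Proof. by apply/piE; rewrite opprD addrACA; apply: is_submodD; [|exact: repP|exact: repP]. Qed.

Let qoppE x : qopp (pi x) = pi (- x).
Proof. by apply/piE; rewrite -opprD; apply: is_submodN => //; exact: repP. Qed.

Let qscaleE a x : qscale a (pi x) = pi (a *: x).
Proof. by apply/piE; rewrite -scalerBr; apply: is_submodZ => //; exact: repP. Qed.

Let qaddA : associative qadd.
Proof. by move=> p q r; rewrite -[p]piK -[q]piK -[r]piK !qaddE addrA. Qed.
Let qaddC : commutative qadd.
Proof. by move=> p q; rewrite -[p]piK -[q]piK !qaddE addrC. Qed.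
Let qadd0 : left_id (pi 0) qadd.
Proof. by move=> p; rewrite -[p]piK !qaddE add0r. Qed.
Let qaddN : left_inverse (pi 0) qopp qadd.
Proof. by move=> p; rewrite -[p]piK qoppE !qaddE addNr. Qed.

HB.instance Definition _ := GRing.isZmodule.Build quotient qaddA qaddC qadd0 qaddN.

Let qscaleA a b p : qscale a (qscale b p) = qscale (a * b) p.
Proof. by rewrite -[p]piK !qscaleE scalerA. Qed.
Let qscale1 : left_id 1 qscale.
Proof. by move=> p; rewrite -[p]piK qscaleE scale1r. Qed.
Let qscaleDr : right_distributive qscale +%R.
Proof.
by move=> a p q; rewrite -[p]piK -[q]piK [_ + _]qaddE !qscaleE [RHS]qaddE scalerDr.
Qed.
Let qscaleDl p : {morph qscale^~ p : a b / a + b}.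
Proof. by move=> a b; rewrite -[p]piK !qscaleE [RHS]qaddE scalerDl. Qed.

HB.instance Definition _ := GRing.Zmodule_isLmodule.Build R quotient
  qscaleA qscale1 qscaleDr qscaleDl.

Lemma quotient_exists : exists (Q : lmodType R) (p : {linear V -> Q}),
  (forall q, exists v, p v = q) /\ forall v, p v = 0 <-> S v.
Proof.
have [|p pE] := @linear_exists R V quotient pi.
  by move=> a x y; rewrite -qaddE -qscaleE.
exists quotient, p; split=> [q|v]; first by exists (quotient_val q); rewrite pE piK.
by rewrite pE -[in X in _ <-> X](subr0 v); exact: piE.
Qed.

End Quotient.

Section Baer.
Variable R : nzRingType.
Implicit Types (A B M : lmodType R).

(** For a submodule of [A * M], this condition at 0 already makes the graph single-valued. *)
Definition functional A M (G : set (A * M)) : Prop := forall m, G (0, m) -> m = 0.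

Lemma functionalP A M (G : set (A * M)) : is_submod G -> functional G ->
  forall x m m', G (x, m) -> G (x, m') -> m = m'.
Proof.
move=> GS Gf x m m' Gm Gm'; apply/eqP; rewrite -subr_eq0; apply/eqP/Gf.
have -> : (0, m - m') = (x, m) - (x, m') by congr pair; rewrite /= subrr.
exact: is_submodB.
Qed.

(** The graph itself serves as the submodule: its first projection is injective because [G] is
    functional, and its second projection is the map to extend. *)
Lemma injective_graph M B (G : set (B * M)) :
  injective_module M -> is_submod G -> functional G ->
  exists g : {linear B -> M}, forall b m, G (b, m) -> g b = m.
Proof.
move=> Minj GS Gf; pose GA := submod (submod_set GS).
have [|i iE] := @linear_exists R GA B (fun x => (\val x).1) => //.
have [|f fE] := @linear_exists R GA M (fun x => (\val x).2) => //.
have iI : injective i.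
  apply: linear_inj => x; rewrite iE => x0; apply: val_inj.
  move: x x0 => [[b m] /= /asboolP Gbm] /= b0; congr pair => //.
  by apply: Gf; rewrite -b0.
have [g gi] := Minj _ _ i f iI; exists g => b m Gbm.
have Gin : (b, m) \in submod_set GS by apply/asboolP.
by have := gi (Submod Gin); rewrite iE fE.
Qed.

(** A maximal partial extension is total, because solving one ideal allows it to be extended by any
    further element. *)
Lemma baer M :
    (forall G : set (R^o * M), is_submod G -> functional G ->
      exists m, forall x y, G (x, y) -> y = x *: m) ->
  injective_module M.
Proof.
move=> HM A B i f iI.
pose P (G : set (B * M)) := is_submod G /\ functional G.
pose G0 : set (B * M) := [set (i a, f a) | a in [set: A]].
have [| F F0 FP Ftot|G [[GS Gf] G0G Gmax]] := @zorn_above _ P G0.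
- split; [split=> [|a _ _ [x _ <-] [y _ <-]]|move=> m [a _ [/eqP]]].
  + by exists 0; rewrite // !linear0.
  + by exists (a *: x + y); rewrite // !linear_comb.
  + by move=> ia0 <-; rewrite (inj_linear0 iI (eqP ia0)) linear0.
- split; [split=> [|a x y [X FX Xx] [Y FY Yy]]|move=> m [X FX Xm]].
  + by case: F0 => X FX; exists X => //; case: (FP X FX) => -[].
  + have [XY|YX] := Ftot _ _ FX FY.
      by exists Y => //; have [[_ YP] _] := FP _ FY; apply: YP => //; apply: XY.
    by exists X => //; have [[_ XP] _] := FP _ FX; apply: XP => //; apply: YX.
  + by have [_ /(_ _ Xm)] := FP _ FX.
have /choice[g gG] : forall b, exists m, G (b, m).
  (* The ideal consists of the r with r b in the domain of [G]; a solution [m0] there is a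
     consistent value at b. *)
  move=> b; pose H : set (R^o * M) := [set x | G (x.1 *: b, x.2)].
  have [||m0 m0P] := HM H.
  - split=> [|a x y Hx Hy]; first by rewrite /H /= scale0r; case: GS.
    rewrite /H /= scalerDl -[a *: x.1 *: b]/((a * x.1) *: b) -scalerA.
    by have := GS.2 a _ _ Hx Hy.
  - by move=> m; rewrite /H /= scale0r; apply: Gf.
  pose G' : set (B * M) := [set u | exists x r, G x /\ u = x + (r *: b, r *: m0)].
  exists m0; apply: (Gmax G').
  - by move=> x Gx; exists x, 0; rewrite !scale0r -[(0, 0)]/(0 : B * M) addr0.
  - split; [split=> [|a _ _ [x [r [Gx ->]]] [y [s [Gy ->]]]]|].
    + by exists 0, 0; rewrite !scale0r -[(0, 0)]/(0 : B * M) addr0; case: GS.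
    + exists (a *: x + y), (a * r + s); split; first by case: GS => _; apply.
      by rewrite scalerDr !scalerDl -!scalerA addrACA.
    + move=> m [[x y] [r [Gxy [/esym/eqP]]]]; rewrite addr_eq0 => /eqP ex ->.
      have /m0P <- : H (r, - y).
        by rewrite /H /= -[r *: b]opprK -ex -[(_, _)]/(- (x, y)); apply: is_submodN.
      by rewrite addrN.
  - exists 0, 1; split; first by case: GS.
    by rewrite add0r !scale1r.
have [|h hE] := @linear_exists R B M g.
  move=> a x y; apply: (functionalP GS Gf (gG _)).
  by have := GS.2 a _ _ (gG x) (gG y).
exists h => x; rewrite hE; apply: (functionalP GS Gf (gG _)).
by apply: G0G; exists x.
Qed.

End Baer.

(** * Enough injectives *)

Section IntModules.
Import Order.TTheory Num.Theory.

Lemma scale_intE (D : lmodType int) (k : int) (d : D) : k *: d = d *~ k.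
Proof. by rewrite -scaler_int intz. Qed.

(** A nonzero ideal of the integers is generated by its least positive element, as remainders modulo
    it are smaller and so vanish. *)
Lemma min_positive_dvd (P : int -> Prop) :
    (forall k l, P k -> P l -> P (k - l)) -> (forall a k, P k -> P (a * k)) ->
    (exists2 k, P k & k <> 0) ->
  exists2 n : nat, (0 < n)%N & P n%:Z /\ forall k, P k -> exists q, k = q * n%:Z.
Proof.
move=> PB PM [k Pk k0].
have exn : exists n : nat, (0 < n)%N && `[< P n%:Z >].
  exists `|k|%N; rewrite absz_gt0; apply/andP; split; first exact/eqP.
  by apply/asboolP; rewrite abszE normrEsign; apply: PM.
have [n /andP[n0 /asboolP Pn] nmin] := ex_minnP exn.
exists n => //; split=> // l Pl; exists (l %/ n)%Z.
have n0' : (n%:Z != 0) by rewrite -lt0n.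
have r_ge0 := modz_ge0 l n0'; have r_lt := ltz_pmod l (n0 : 0 < n%:Z).
have Pr : P (l %% n)%Z by rewrite /modz; apply/PB/PM.
rewrite {1}(divz_eq l n); case: (l %% n)%Z r_ge0 r_lt Pr => // -[|r] _ r_lt Pr.
  by rewrite addr0.
have /nmin : (0 < r.+1)%N && `[< P r.+1%:Z >] by apply/andP; split=> //; apply/asboolP.
by rewrite leqNgt -ltz_nat r_lt.
Qed.

Lemma divisible_injective (D : lmodType int) :
    (forall n : nat, (0 < n)%N -> forall d : D, exists e, n%:Z *: e = d) ->
  injective_module D.
Proof.
move=> Ddiv; apply: baer => G GS Gf.
pose P (k : int) := exists d, G (k, d).
have [[k Pk k0]|nP] := pselect (exists2 k, P k & k <> 0); last first.
  exists 0 => k d Gkd; have k0 : k = 0.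
    by apply: contrapT => k0; apply: nP; exists k => //; exists d.
  by rewrite scaler0; apply: Gf; rewrite -k0.
have [||n n0 [[d Gnd] nP]] := @min_positive_dvd P _ _ (ex_intro2 _ _ k Pk k0).
- by move=> a b [d Gd] [e Ge]; exists (d - e); have := is_submodB GS Gd Ge.
- by move=> a b [d Gd]; exists (a *: d); have := is_submodZ a GS Gd.
have [m md] := Ddiv n n0 d; exists m => x y Gxy.
have [q xq] := nP x (ex_intro _ y Gxy).
apply: (functionalP GS Gf Gxy); rewrite xq -scalerA md.
by have := is_submodZ q GS Gnd.
Qed.

(** The module is Q/Z; the class of 1/n is killed by n and nonzero for n > 1. *)
Lemma rat_mod_int : exists D : lmodType int, injective_module D /\
  forall n : nat, (1 < n)%N -> exists2 e : D, e <> 0 & n%:Z *: e = 0.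
Proof.
pose V : lmodType int := zmodule rat.
pose S : set V := [set x | exists z : int, x = z%:~R :> rat].
have SS : is_submod S.
  split=> [|a _ _ [x ->] [y ->]]; first by exists 0.
  exists (a * x + y); rewrite scale_intE -[LHS]/((x%:~R : rat) *~ a + y%:~R).
  by rewrite intrD intrM mulrzl.
have [Q [p [psurj pK]]] := quotient_exists SS.
pose inv (n : nat) (x : rat) : V := (n%:R^-1 * x)%R.
have invK (n : nat) (x : rat) : (0 < n)%N -> n%:Z *: inv n x = x :> rat.
  move=> n0; rewrite scale_intE -[LHS]/((n%:R^-1 * x) *+ n) -mulr_natl mulrA.
  by rewrite divff ?mul1r // pnatr_eq0 -lt0n.
exists Q; split.
  apply: divisible_injective => n n0 d; have [x <-] := psurj d.
  by exists (p (inv n x)); rewrite -linearZ; congr (p _); apply: invK.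
move=> n n1; have n0 : (0 < n)%N by apply: ltnW.
exists (p (inv n 1)); last by rewrite -linearZ; apply/pK; exists 1; apply: invK.
move=> /pK[z zE]; have := invK n 1 n0; rewrite zE scale_intE.
rewrite -[LHS]/((z%:~R : rat) *+ n) -mulr_natr -[n%:R]/(n%:Z%:~R) -intrM => /eqP.
rewrite -[1]/(1%:~R) eqr_int => /eqP zn1.
have := congr1 absz zn1; rewrite abszM => /eqP; rewrite muln_eq1 => /andP[_ /eqP/= n1'].
by rewrite n1' in n1.
Qed.

(** Q/Z cogenerates: v is sent to a nonzero element killed by its annihilator. The generator of a
    nonzero annihilator is not 1 because v is nonzero; if the annihilator is 0, any nonzero element
    will do. *)
Lemma int_character : exists D : lmodType int, injective_module D /\
  forall (V : lmodType int) (v : V), v <> 0 -> exists g : {linear V -> D}, g v <> 0.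
Proof.
have [D [Dinj De]] := rat_mod_int; exists D; split=> // V v v0.
pose P (k : int) := k *: v = 0.
have [e e0 eP] : exists2 e : D, e <> 0 & forall k, P k -> k *: e = 0.
  have [Pk|nP] := pselect (exists2 k, P k & k <> 0); last first.
    have [e e0 _] := De 2 isT; exists e => // k Pk; have -> : k = 0.
      by apply: contrapT => k0; apply: nP; exists k.
    by rewrite scale0r.
  have [||n n0 [Pn nP]] := min_positive_dvd _ _ Pk.
  - by move=> k l; rewrite /P scalerBl => -> ->; rewrite subr0.
  - by move=> a k; rewrite /P -scalerA => ->; rewrite scaler0.
  have [e e0 ne] : exists2 e : D, e <> 0 & n%:Z *: e = 0.
    apply: De; case: n n0 Pn {nP} => [|[|n]] // _; rewrite /P scale1r => /v0 //.
  by exists e => // k /nP[q ->]; rewrite -scalerA ne scaler0.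
pose G : set (V * D) := [set (k *: v, k *: e) | k in [set: int]].
have [||g gE] := injective_graph (G := G) Dinj.
- split=> [|a _ _ [x _ <-] [y _ <-]]; first by exists 0; rewrite // !scale0r.
  by exists (a * x + y) => //; rewrite !scalerDl -!scalerA.
- by move=> m [k _ [/eP ke <-]].
exists g; rewrite (gE v e) //; exists 1 => //.
by rewrite !scale1r.
Qed.

End IntModules.

Section Coinduced.
Variables (R : nzRingType) (D : lmodType int).

Definition additive_funs : set (R -> D) := [set f | forall x y, f (x + y) = f x + f y].

Fact additive_funs_submod : @is_submod int (R -> D) additive_funs.
Proof.
split=> [x y|a f g /= fD gD x y]; first by rewrite addr0.
rewrite -[LHS]/(a *: f (x + y) + g (x + y)) fD gD scalerDr addrACA.
by [].
Qed.

(** This is Hom_Z(R, D), made a left R-module by (a f)(s) = f(s a). *)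
Definition coinduced : Type := submod (submod_set additive_funs_submod).
HB.instance Definition _ := GRing.Zmodule.on coinduced.

Definition coind_fun (f : coinduced) : R -> D := \val f.

Lemma coind_funD (f : coinduced) x y : coind_fun f (x + y) = coind_fun f x + coind_fun f y.
Proof. by move: (submod_valP f) => /asboolP. Qed.

Lemma coind_funMz (f : coinduced) k s : coind_fun (f *~ k) s = coind_fun f s *~ k.
Proof.
have fM n : coind_fun (f *+ n) s = coind_fun f s *+ n.
  by elim: n => // n IHn; rewrite !mulrSr -IHn.
by case: k => n; [exact: fM|rewrite -[RHS]/(- (coind_fun f s *+ n.+1)) -fM].
Qed.

Lemma coinducedP (f g : coinduced) : coind_fun f =1 coind_fun g -> f = g.
Proof. by move=> fg; apply: val_inj; apply/funext. Qed.

Lemma coind_exists (f : R -> D) : (forall x y, f (x + y) = f x + f y) ->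
  exists g : coinduced, coind_fun g =1 f.
Proof.
move=> fD; have fin : f \in submod_set additive_funs_submod by apply/asboolP.
by exists (Submod fin).
Qed.

Fact coind_scale_subproof a (f : coinduced) :
  (fun s => coind_fun f (s * a)) \in submod_set additive_funs_submod.
Proof. by apply/asboolP => x y; rewrite mulrDl coind_funD. Qed.

Definition coind_scale a (f : coinduced) : coinduced := Submod (coind_scale_subproof a f).

Fact coind_scaleA a b f : coind_scale a (coind_scale b f) = coind_scale (a * b) f.
Proof. by apply: coinducedP => s; rewrite /coind_fun /= mulrA. Qed.
Fact coind_scale1 : left_id 1 coind_scale.
Proof. by move=> f; apply: coinducedP => s; rewrite /coind_fun /= mulr1. Qed.
Fact coind_scaleDr : right_distributive coind_scale +%R.
Proof. by move=> a f g; apply: coinducedP => s. Qed.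
Fact coind_scaleDl f : {morph coind_scale^~ f : a b / a + b}.
Proof.
by move=> a b; apply: coinducedP => s; rewrite /coind_fun /= mulrDr coind_funD.
Qed.

HB.instance Definition _ := GRing.Zmodule_isLmodule.Build R coinduced
  coind_scaleA coind_scale1 coind_scaleDr coind_scaleDl.

Lemma coind_mor (V : lmodType R) (g : {linear zmodule V -> D}) :
  exists h : {linear V -> coinduced}, forall v s, coind_fun (h v) s = g (s *: v : V).
Proof.
have gD (x y : V) : g (x + y : V) = g x + g y by exact: (raddfD g).
have /choice[h hE] (v : V) : exists h : coinduced, forall s, coind_fun h s = g (s *: v).
  by apply: coind_exists => x y; rewrite scalerDl gD.
have [|H HE] := @linear_exists R V coinduced h.
  move=> a x y; apply: coinducedP => s; rewrite hE.
  rewrite -[RHS]/(coind_fun (h x) (s * a) + coind_fun (h y) s) !hE.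
  by rewrite scalerDr scalerA gD.
by exists H => v s; rewrite HE hE.
Qed.

(** By adjunction: evaluation at 1 gives an additive map to D, which is extended over int and turned
    back by [coind_mor]. *)
Lemma coinduced_injective : injective_module D -> injective_module coinduced.
Proof.
move=> Dinj A B i f iI.
pose G : set (zmodule B * D) := [set (i a : zmodule B, coind_fun (f a) 1) | a in [set: A]].
have [||g gE] := injective_graph (G := G) Dinj.
- split=> [|k _ _ [x _ <-] [y _ <-]].
    by exists 0; rewrite // !linear0.
  exists (x *~ k + y) => //; congr pair.
    by rewrite raddfD raddfMz.
  rewrite raddfD raddfMz.
  rewrite -[LHS]/(coind_fun (f x *~ k) 1 + coind_fun (f y) 1) coind_funMz.
  by rewrite -scale_intE.
- by move=> m [a _ [/(inj_linear0 iI)-> <-]]; rewrite linear0.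
have [h hE] := coind_mor g; exists h => a; apply: coinducedP => s.
rewrite hE (gE _ (coind_fun (f (s *: a)) 1)); last by exists (s *: a); rewrite ?linearZ.
rewrite linearZ -[LHS]/(coind_fun (f a) (1 * s)).
by rewrite mul1r.
Qed.

End Coinduced.

Section EnoughInjectives.
Variable R : nzRingType.
Implicit Types M N V : lmodType R.

Lemma injective_cogenerator : exists C : lmodType R, injective_module C /\
  forall V (v : V), v <> 0 -> exists g : {linear V -> C}, g v <> 0.
Proof.
have [D [Dinj Dc]] := int_character.
exists (coinduced R D); split=> [|V v v0]; first exact: coinduced_injective.
have [g gv] := Dc (zmodule V) v v0; have [h hE] := coind_mor g; exists h => hv.
by apply: gv; have := hE v 1; rewrite scale1r hv => <-.
Qed.

Lemma injective_funs I M : injective_module M -> injective_module (I -> M : lmodType R).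
Proof.
move=> Minj A B i f iI.
have /choice[g gE] t : exists g : {linear B -> M}, forall a, g (i a) = f a t.
  have [|ft ftE] := @linear_exists R A M (fun a => f a t).
    by move=> a x y; rewrite linear_comb.
  by have [g gE] := Minj _ _ i ft iI; exists g => a; rewrite gE ftE.
have [|h hE] := @linear_exists R B (I -> M) (fun b t => g t b).
  by move=> a x y; apply/funext => t; rewrite linear_comb.
by exists h => a; rewrite hE; apply/funext => t; rewrite gE.
Qed.

(** In a power of the cogenerator, the coordinate [e x] carries a homomorphism that does not vanish
    at x. The size of this power is uncontrolled; [injective_closure] cuts it down. *)
Lemma injective_universal (T : Type) : exists G : lmodType R, injective_module G /\
  forall N, embeds N T -> exists f : {linear N -> G}, injective f.
Proof.
have [C [Cinj Cc]] := injective_cogenerator.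
exists (T -> C : lmodType R); split=> [|N [e eI]]; first exact: injective_funs.
have /choice[g gE] (x : N) : exists g : {linear N -> C}, x <> 0 -> g x <> 0.
  have [->|/Cc[g gx]] := pselect (x = 0); last by exists g.
  have [|g _] := @linear_exists R N C (fun=> 0); last by exists g.
  by move=> a y z; rewrite scaler0 addr0.
have /choice[k kE] (t : T) : exists k : {linear N -> C}, forall x, t = e x -> k = g x.
  have [[x ->]|nx] := pselect (exists x, t = e x); first by exists (g x) => y /eI ->.
  by exists (g 0) => x tx; case: nx; exists x.
have [|h hE] := @linear_exists R N (T -> C) (fun n t => k t n).
  by move=> a x y; apply/funext => t; rewrite linear_comb.
exists h; apply: linear_inj => x; rewrite hE => /(congr1 (fun f => f (e x))).
by rewrite (kE _ x) // => gx0; apply: contrapT => /gE.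
Qed.

End EnoughInjectives.

(** * Universal injective modules *)

Section LSCardinal.
Variable R : nzRingType.

Lemma LS_ring T : embeds (LS R) T -> embeds R T.
Proof. by apply: embeds_trans; exists inl => x y []. Qed.

Lemma LS_nat T : embeds (LS R) T -> embeds nat T.
Proof. by apply: embeds_trans; exists inr => x y []. Qed.

Lemma LS_infinite : embeds nat (LS R).
Proof. exact/LS_nat/embeds_refl. Qed.

End LSCardinal.

Section OperationClosure.
Variables (R : nzRingType) (T Op : Type) (Ar : Op -> Type).
Variables (E : lmodType R) (L : Type) (X : L -> E) (sol : forall a, (Ar a -> E) -> E).

(** Terms name the elements of the closure of [X] under linear combinations and [sol]. Counting
    terms bounds the closure at once, with no transfinite iteration even for infinite arities. *)
Inductive op_term : Type :=
  | Leaf of L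
  | Lin of R & op_term & op_term
  | App a of Ar a -> op_term.

Fixpoint op_eval (t : op_term) : E := match t with
  | Leaf l => X l
  | Lin r x y => r *: op_eval x + op_eval y
  | App a k => sol (fun i => op_eval (k i))
  end.

Lemma op_term_embeds : embeds nat T -> embeds R T -> embeds L T ->
  embeds {a & Ar a -> T} T -> embeds op_term T.
Proof.
move=> Tinf RT LT AT.
have [c cI] : embeds (L + (R * (T * T)) + {a & Ar a -> T}) T.
  do ?[apply: embeds_inf_sum => //|apply: embeds_inf_prod => //];
  exact: embeds_refl.
pose enc := fix enc t := match t with
  | Leaf l => c (inl (inl l))
  | Lin r x y => c (inl (inr (r, (enc x, enc y))))
  | App a k => c (inr (existT _ a (fun i => enc (k i))))
  end.
exists enc; elim=> [l|r x IHx y IHy|a k IHk] [l'|r' x' y'|a' k'] //= /cI //.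
- by move=> [->].
- by move=> [-> /IHx-> /IHy->].
- move=> [eaa']; case: _ / eaa' k' => k' ek; congr App; apply/funext => i.
  apply: IHk; exact: (congr1 (fun f => f i) (existT_injr ek)).
Qed.

Lemma op_closure : embeds (LS R) T -> embeds L T -> inhabited L ->
    embeds {a & Ar a -> T} T ->
  exists W : submodClosed E, [/\ forall l, X l \in W, embeds (submod W) T &
    forall a k, (forall i, k i \in W) -> @sol a k \in W].
Proof.
move=> LST LT [l0] AT.
have RT := LS_ring LST.
have NT := LS_nat LST.
have SS : is_submod (range op_eval).
  split=> [|a _ _ [x _ <-] [y _ <-]]; last by exists (Lin a x y).
  (* No term stands for 0, which is obtained as -x + x from a leaf. *)
  by exists (Lin (-1) (Leaf l0) (Leaf l0)); rewrite //= scaleN1r addNr.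
exists (submod_set SS); split=> [l||a k kW].
- by apply/asboolP; exists (Leaf l).
- apply: embeds_trans (op_term_embeds NT RT LT AT).
  have tE t : op_eval t \in submod_set SS by apply/asboolP; exists t.
  apply: (@embeds_surj _ _ (fun t => Submod (tE t))) => -[x xS].
  by have /asboolP[t _ tx] := xS; exists t; apply: val_inj.
- have /choice[t tE] i : exists t, op_eval t = k i.
    by have /asboolP[t _ tx] := kW i; exists t.
  apply/asboolP; exists (App t) => //=; congr sol; apply/funext => i; exact: tE.
Qed.

End OperationClosure.

Section Coded.
Variable R : nzRingType.
Implicit Types (T : Type) (A B E M N W : lmodType R).

Definition span (U : Type) M (d : U -> M) : set M :=
  [set x | forall J : set M, is_submod J -> (forall i, J (d i)) -> J x].

Lemma span_submod U M (d : U -> M) : is_submod (span d).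
Proof.
split=> [J [J0 _]//|a x y dx dy J JS Jd].
by case: (JS) => _; apply; [apply: dx|apply: dy].
Qed.

Lemma span_gen U M (d : U -> M) i : span d (d i).
Proof. by move=> J _; apply. Qed.

Arguments span_gen {U M} d i J _ _.

(* Bounds by T both the number of left ideals and the number of linear systems
   in one unknown over a module of cardinality T. Over a noetherian ring this
   holds for every T >= LS R, over any ring for T = 2 ^ LS R. *)
Definition coded T : Prop := exists (Op : Type) (Ar : Op -> Type)
    (dom : forall a, Ar a -> R^o),
  embeds {a & Ar a -> T} T /\
  forall J : set R^o, is_submod J -> exists a, span (dom a) = J.

(** Each ideal lists its own elements, and a map from it to subsets of LS R is a subset of LS R * LS
    R. *)
Lemma coded_power : coded (LS R -> Prop).
Proof.
pose Ar (J : set R^o) := {x | J x}.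
exists (set R^o), Ar, (fun J x => sval x); split; last first.
  move=> J JS; exists J; apply/seteqP; split=> x; first by apply=> // -[].
  by move=> Jx J' J'S J'x; have := J'x (exist _ x Jx).
have [c cI] : embeds (LS R * LS R) (LS R) by apply: embeds_square; apply: LS_infinite.
have cIE x y x' y' : c (x, y) = c (x', y') -> x = x' /\ y = y' by move=> /cI[].
(* A first component [inr 0] records the domain, a first component [inl] the values. *)
pose enc (p : {J : set R^o & Ar J -> LS R -> Prop}) : LS R -> Prop := fun z =>
  (exists2 x : R, projT1 p x & z = c (inr 0%N, inl x)) \/
  (exists (x : Ar (projT1 p)) y, projT2 p x y /\ z = c (inl (sval x), y)).
exists enc => -[J k] [J' k'] eqp.
have eJ : J = J'.
  apply/seteqP; split=> x Jx.
    have : enc (existT _ J k) (c (inr 0%N, inl x)) by left; exists x.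
    by rewrite eqp => -[[y J'y /cIE[_ [->]]]|[y [z [_ /cIE[]]]]].
  have : enc (existT _ J' k') (c (inr 0%N, inl x)) by left; exists x.
  by rewrite -eqp => -[[y J'y /cIE[_ [->]]]|[y [z [_ /cIE[]]]]].
case: _ / eJ k' eqp => k' eqp; congr existT; apply/funext => x; apply/funext => y.
apply/propext; split=> kxy.
  have : enc (existT _ J k) (c (inl (sval x), y)) by right; exists x, y.
  by rewrite eqp => -[[z _ /cIE[]]|[x' [y' [kxy' /cIE[[/sval_inj->] ->]]]]].
have : enc (existT _ J k') (c (inl (sval x), y)) by right; exists x, y.
by rewrite -eqp => -[[z _ /cIE[]]|[x' [y' [kxy' /cIE[[/sval_inj->] ->]]]]].
Qed.

(** Otherwise, adding again and again an element outside the span of the previous ones gives a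
    strictly ascending chain. *)
Lemma noetherian_finitely_generated (J : set R^o) : left_noetherian R -> is_submod J ->
  exists s : seq R^o, span (fun i : 'I_(size s) => s`_i) = J.
Proof.
move=> Rn JS; pose sp (s : seq R^o) := span (fun i : 'I_(size s) => s`_i).
have spJ s : (forall x, x \in s -> J x) -> sp s `<=` J.
  by move=> sJ x; apply=> // i; apply: sJ; apply: mem_nth.
have spI s x : x \in s -> sp s x.
  by move=> /(nthP 0)[i si <-]; apply: (@span_gen _ _ (fun i : 'I_(size s) => s`_i) (Ordinal si)).
apply: contrapT => nfg.
have /choice[next nextP] (s : seq R^o) : exists x,
    (forall y, y \in s -> J y) -> J x /\ ~ sp s x.
  have [sJ|nsJ] := pselect (forall y, y \in s -> J y); last by exists 0 => /nsJ.
  have [[x Jx nx]|nx] := pselect (exists2 x, J x & ~ sp s x); first by exists x.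
  case: nfg; exists s; apply/seteqP; split=> [|x Jx]; first exact: spJ.
  by apply: contrapT => nsx; apply: nx; exists x.
pose s n := iter n (fun t => next t :: t) [::].
have sJ n y : y \in s n -> J y.
  elim: n y => // n IHn y; rewrite /= inE => /orP[/eqP->|/IHn//].
  by have [] := nextP _ IHn.
pose C n : submodClosed R^o := submod_set (@span_submod _ _ (fun i : 'I_(size (s n)) => (s n)`_i)).
have CE n x : (x \in C n) = `[< sp (s n) x >] by [].
have [|n nP] := Rn C.
  move=> n x; rewrite !CE => /asboolP spx; apply/asboolP; apply: spx.
    exact: span_submod.
  by move=> i; apply: (@spI (next (s n) :: s n)); rewrite inE mem_nth ?orbT.
have := nP n.+1 (leqnSn n) (next (s n)); rewrite !CE.
have [_ /asboolPn/negbTE->] := nextP _ (@sJ n).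
by move=> /negbT/asboolPn; apply; apply: (@spI (next (s n) :: s n)); apply: mem_head.
Qed.

Lemma coded_noetherian T : left_noetherian R -> embeds (LS R) T -> coded T.
Proof.
move=> Rn LST.
have RT := LS_ring LST.
have NT := LS_nat LST.
exists (seq R^o), (fun s => 'I_(size s)), (fun s i => s`_i); split; last first.
  by move=> J; apply: noetherian_finitely_generated.
have := embeds_inf_prod NT (embeds_inf_seq NT RT) (embeds_inf_seq NT (embeds_refl T)).
apply: embeds_trans; exists (fun p => (projT1 p, map (projT2 p) (enum 'I_(size (projT1 p))))).
move=> [s k] [s' k'] /= [es]; case: _ / es k' => k' ek; congr existT.
by apply/funext => i; have /eq_in_map := ek; apply; rewrite mem_enum.
Qed.

Lemma coded_embeds_op T Op (Ar : Op -> Type) :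
  T -> embeds {a & Ar a -> T} T -> embeds Op T.
Proof.
move=> t; apply: embeds_trans; exists (fun a => existT _ a (fun=> t)) => a b.
by move=> /(congr1 (@projT1 _ _)).
Qed.

(** A homomorphism from a left ideal into W is a linear system in one unknown, solvable in the
    injective E. Closing W under chosen solutions makes it satisfy Baer's criterion, and [coded]
    bounds the number of systems. *)
Lemma injective_closure T E L (X : L -> E) : coded T -> embeds (LS R) T ->
    embeds L T -> inhabited L -> injective_module E ->
  exists W : submodClosed E, [/\ forall l, X l \in W, embeds (submod W) T &
    injective_module (submod W)].
Proof.
move=> [Op [Ar [dom [AT domP]]]] LST LT L0 Einj.
(* Unsolvable systems get the default value 0. *)
have /choice[sol solP] (p : {a & Ar a -> E}) : exists x : E,
    (exists y, forall i, dom (projT1 p) i *: y = projT2 p i) ->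
    forall i, dom (projT1 p) i *: x = projT2 p i.
  have [[y yP]|np] := pselect (exists y, forall i, dom (projT1 p) i *: y = projT2 p i).
    by exists y.
  by exists 0 => /np.
have [W [XW WT solW]] := op_closure X (fun a k => sol (existT _ a k)) LST LT L0 AT.
exists W; split=> //; apply: baer => G GS Gf.
pose GE : set (R^o * E) := [set (x.1, \val x.2) | x in G].
have [e eE] : exists e : E, forall x y, G (x, y) -> \val y = x *: e.
  have [||g gE] := injective_graph (G := GE) Einj.
  - split=> [|a _ _ [x Gx <-] [y Gy <-]]; first by exists 0 => //; case: GS.
    by exists (a *: x + y) => //; case: GS => _; apply.
  - move=> m [[x y] Gxy [/= x0 <-]]; rewrite x0 in Gxy.
    by rewrite (Gf _ Gxy).
  exists (g 1) => x y Gxy; rewrite -linearZ.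
  by rewrite (gE _ (\val y)) //; exists (x, y) => //=; rewrite -[x *: _]/(x * 1) mulr1.
have [|a aP] := domP [set x | exists y, G (x, y)].
  split=> [|b x x' [y Gy] [y' Gy']]; first by exists 0; case: GS.
  by exists (b *: y + y'); have := GS.2 b _ _ Gy Gy'.
have /choice[k kE] i : exists y, G (dom a i, y).
  by have := span_gen (dom a) i; rewrite aP.
have wW := solW a _ (fun i => submod_valP (k i)).
set w := sol _ in wW; have wP i : dom a i *: w = \val (k i).
  by have /(_ i) := solP (existT _ a (fun i => \val (k i)))
    (ex_intro _ e (fun i => esym (eE _ _ (kE i)))).
exists (Submod wW) => x y Gxy.
(* [w] is only known to solve the system on generators; the x at which it agrees with [G] form a
   submodule. *)
have [|||y' Gxy' y'E] := (_ : span (dom a) x) [set x | exists2 y, G (x, y) & \val y = x *: w].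
- by rewrite aP; exists y.
- split=> [|b z z' [u Gu uE] [u' Gu' u'E]].
    by exists 0; rewrite ?scale0r //; case: GS.
  exists (b *: u + u'); first by have := GS.2 b _ _ Gu Gu'.
  by rewrite submod_val_linear uE u'E scalerDl -scalerA.
- by move=> i; exists (k i) => //; rewrite wP.
by apply: val_inj; rewrite (functionalP GS Gf Gxy Gxy').
Qed.

(* Embed a submodule generated by a maximal independent family of elements b,
   sending b to a fresh element with the same annihilator; this submodule is
   essential, so any extension of the embedding is an embedding. *)
Lemma coded_universal_injective T : coded T -> embeds (LS R) T ->
  exists W, [/\ injective_module W, embeds W T, embeds T W &
    forall N, embeds N T -> exists f : {linear N -> W}, injective f].
Proof.
move=> Tc LST; have [Op [Ar [dom [AT domP]]]] := Tc.
have RT := LS_ring LST.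
have NT := LS_nat LST.
have [G [Ginj GP]] := injective_universal R T.
(* [g a] is the class of 1 in R modulo the ideal coded by [a], so that ideal is its annihilator. *)
have /choice[g gE] a : exists g : G, forall s, s *: g = 0 <-> span (dom a) s.
  have [Q [p [psurj pK]]] := quotient_exists (span_submod (dom a)).
  have [|f fI] := GP Q; first by apply: embeds_trans (embeds_surj psurj) RT.
  exists (f (p 1)) => s; rewrite -!linearZ -pK -[s *: 1]/(s * 1) mulr1.
  by split=> [/(inj_linear0 fI)|->] //; rewrite linear0.
(* A copy of [g a] for each t, at a coordinate of its own, so that copies are independent. *)
pose X (al : Op * T) : Op * T -> G := fun bl => if `[< bl = al >] then g al.1 else 0.
have XE al : X al al = g al.1 by rewrite /X asboolT.
have X0 al bl : X al bl <> 0 -> bl = al by rewrite /X; case: asboolP.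
have rX r al : r *: g al.1 = 0 -> r *: X al = 0.
  move=> rg; apply/funext => bl; rewrite /X -[LHS]/(r *: if `[< bl = al >] then _ else _).
  by case: asboolP => // _; rewrite scaler0.
have [t0] : inhabited T by have [i _] := NT; exists; apply: (i 0%N).
(* The zero ideal provides a nonzero [g a0], whose copies make W at least as large as T. *)
have [a0 a0P] : exists a, span (dom a) = [set 0].
  by apply: domP; split=> // a x y /= -> ->; rewrite scaler0 addr0.
have ga0 : g a0 <> 0.
  move=> g0; have /(gE a0 1) : 1 *: g a0 = 0 by rewrite g0 scaler0.
  by rewrite a0P /= => /eqP; rewrite oner_eq0.
have OpT : embeds (Op * T) T.
  by apply: embeds_inf_prod (coded_embeds_op t0 AT) (embeds_refl T).
have [|W [XW WT Winj]] := injective_closure X Tc LST OpT (inhabits (a0, t0)).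
  exact: injective_funs.
exists (submod W); split=> //.
  exists (fun t => Submod (XW (a0, t))) => t u /(congr1 (fun x => \val x (a0, t))) /=.
  by rewrite XE => e; have /X0[] : X (a0, u) (a0, t) <> 0 by rewrite -e.
move=> N [e eI].
(* Partial embeddings; the last clause keeps every coordinate (a, e n) free until n enters the
   domain. *)
pose P (H : set (N * submod W)) := [/\ is_submod H, functional H,
  forall n, H (n, 0) -> n = 0 &
  forall n w al, H (n, w) -> \val w al <> 0 -> exists n' w', H (n', w') /\ al.2 = e n'].
have [|F F0 FP Ftot|H [[HS Hf Hi Hs] _ Hmax]] := @zorn_above _ P [set 0].
- split=> [|m [->]|n [->]|n w al [_ ->]] //.
  by split=> // a x y -> ->; rewrite scaler0 addr0.
- split.
  + split=> [|a x y [Y FY Yx] [Z FZ Zy]].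
      by case: F0 => Y FY; exists Y => //; have [[]] := FP _ FY.
    have [YZ|ZY] := Ftot _ _ FY FZ.
      by exists Z => //; have [[_ ZP] _ _ _] := FP _ FZ; apply: ZP => //; apply: YZ.
    by exists Y => //; have [[_ YP] _ _ _] := FP _ FY; apply: YP => //; apply: ZY.
  + by move=> m [Y FY Ym]; have [_ YP _ _] := FP _ FY; apply: YP.
  + by move=> n [Y FY Yn]; have [_ _ YP _] := FP _ FY; apply: YP.
  + move=> n w al [Y FY Yn] wal; have [_ _ _ YP] := FP _ FY.
    by have [n' [w' [Yn' E']]] := YP _ _ _ Yn wal; exists n', w'; split=> //; exists Y.
have [f fE] := injective_graph Winj HS Hf; exists f; apply: linear_inj => n fn0.
(* [A] is the domain of [H]. A nonzero multiple of n in it contradicts injectivity of [H]; if R n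
   meets it only in 0, then n can be added. *)
apply: contrapT => n0; pose A m := exists w, H (m, w).
have AN m : A m -> A (- m) by move=> [w Hw]; exists (- w); have := is_submodN HS Hw.
have [[r Ar_ rn]|nr] := pselect (exists2 r, A (r *: n) & r *: n <> 0).
  case: Ar_ => w Hw; apply: rn; apply: Hi.
  have w0 : w = 0 by rewrite -(fE _ _ Hw) linear_scale fn0 scaler0.
  by rewrite w0 in Hw.
have {}nr r : A (r *: n) -> r *: n = 0.
  by move=> Ar_; apply: contrapT => rn; apply: nr; exists r.
have nA : ~ A n by rewrite -[n]scale1r => /nr; rewrite scale1r.
have [|a aP] := domP [set r | r *: n = 0].
  split=> [|b x y /= xn yn]; first by rewrite /= scale0r.
  by rewrite scalerDl -[b *: x]/(b * x) -scalerA xn yn scaler0 addr0.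
have {}gE r : r *: g a = 0 <-> r *: n = 0 by rewrite gE aP.
(* As n is not in the domain, this copy is fresh, and it has the annihilator of n. *)
pose w0 : submod W := Submod (XW (a, e n)).
have rw0 r : r *: n = 0 -> r *: w0 = 0.
  by move=> /gE rg; apply: val_inj; rewrite -[LHS]/(r *: X (a, e n)); apply: (rX _ (a, e n)).
pose H' : set (N * submod W) := [set u | exists x r, H x /\ u = x + (r *: n, r *: w0)].
have HH' : H `<=` H'.
  by move=> x Hx; exists x, 0; rewrite !scale0r -[(0, 0)]/(0 : N * submod W) addr0.
have H'n : H' (n, w0).
  by exists 0, 1; rewrite add0r !scale1r; split=> //; case: HS.
case: (nA); exists w0; apply: (Hmax H') => //; split.
- split=> [|b _ _ [x [r [Hx ->]]] [y [s [Hy ->]]]]; first by apply: HH'; case: HS.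
  exists (b *: x + y), (b * r + s); split; first by case: HS => _; apply.
  by rewrite scalerDr !scalerDl -!scalerA addrACA.
- move=> m [[x y] [r [Hxy [/esym/eqP]]]]; rewrite addr_eq0 => /eqP ex ->.
  have rn : r *: n = 0 by apply: nr; rewrite -[r *: n]opprK -ex; apply: AN; exists y.
  rewrite rw0 // addr0; apply: Hf; rewrite -[X in H (X, _)](_ : x = 0) //.
  by rewrite ex rn oppr0.
- move=> m [[x y] [r [Hxy [-> /esym/eqP]]]]; rewrite addr_eq0 => /eqP ey.
  have {}ey : y = - (r *: w0) by apply: val_inj.
  have rn : r *: n = 0.
    apply/gE; apply: contrapT => rg.
    have [|n' [w' [Hn' /eI nn']]] := Hs _ _ (a, e n) Hxy.
      rewrite ey -[\val _ _]/(- (r *: X (a, e n) (a, e n))) XE => /eqP.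
      by rewrite oppr_eq0 => /eqP.
    by apply: nA; exists w'; rewrite nn'.
  rewrite rn addr0; apply: Hi; rewrite -[X in H (_, X)](_ : y = 0) //.
  by rewrite ey rw0 // oppr0.
- move=> m w al [[x y] [r [Hxy [_ ->]]]] yw.
  have [y0|yal] := pselect (\val y al = 0); last first.
    by have [n' [w' [/HH' Hn' E']]] := Hs _ _ _ Hxy yal; exists n', w'.
  exists n, w0; split=> //; rewrite (X0 (a, e n) al) // => Xal; apply: yw.
  by rewrite -[LHS]/(\val y al + r *: X (a, e n) al) y0 Xal scaler0 addr0.
Qed.

Definition univ_ext T A B (j : A -> B) : Prop :=
  forall N (i : {linear A -> N}), injective i -> embeds N T ->
    exists f : {linear N -> B}, injective f /\ forall x, f (i x) = j x.

(** The first coordinate extends [c]; the second embeds the quotient of N by the image of A, so it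
    vanishes only on that image. *)
Lemma extension_split T A E N W (c : {linear A -> E}) (i : {linear A -> N}) :
    injective_module E -> injective i -> embeds N T ->
    (forall M, embeds M T -> exists f : {linear M -> W}, injective f) ->
  exists f : {linear N -> (E * W)%type},
    (forall x, f (i x) = (c x, 0)) /\ forall y, (f y).2 = 0 -> exists x, i x = y.
Proof.
move=> Einj iI NT WP; have [h hE] := Einj _ _ i c iI.
have [|Q [p [psurj pK]]] := @quotient_exists R N (range i).
  split=> [|a _ _ [x _ <-] [y _ <-]]; first by exists 0; rewrite ?linear0.
  by exists (a *: x + y); rewrite ?linear_comb.
have [|w wI] := WP Q; first exact: embeds_trans (embeds_surj psurj) NT.
have [|f fE] := @linear_exists R N (E * W)%type (fun x => (h x, w (p x))).
  by move=> a x y; rewrite !linear_comb.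
exists f; split=> [x|y].
  by rewrite fE hE (_ : p (i x) = 0) ?linear0 //; apply/pK; exists x.
by rewrite fE => /(inj_linear0 wI)/pK[x _ ix]; exists x.
Qed.

Lemma univ_ext_prod T A E W (j : {linear A -> E}) :
    injective_module E -> injective j ->
    (forall N, embeds N T -> exists f : {linear N -> W}, injective f) ->
  univ_ext T (fun x => (j x, 0) : E * W).
Proof.
move=> Einj jI WP N i iI NT.
have [f [fi f0]] := extension_split j Einj iI NT WP.
exists f; split=> //; apply: linear_inj => x fx.
have [|y iy] := f0 x; first by rewrite fx.
by move: fx; rewrite -iy fi => -[/(inj_linear0 jI)-> ]; rewrite linear0.
Qed.

End Coded.

Arguments span_gen {R U M} d i J _ _.

(** * Well-orders *)

Section WellOrder.
Variables (I : Type) (le : rel I).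
Hypothesis wo : well_order le.
Local Notation lt := (ord_lt le).

(** [well_order] only provides unique least elements; the order axioms below come from sets of at
    most three points. *)
Lemma wo_min (P : I -> Prop) : (exists i, P i) -> exists2 m, P m & forall j, P j -> le m j.
Proof.
move=> [i Pi]; have [|m [[/asboolP Pm mP] _]] := wo (A := fun i => `[< P i >]).
  by exists i; apply/asboolP.
by exists m => // j Pj; apply: mP; apply/asboolP.
Qed.

Lemma wo_refl i : le i i.
Proof. by have [|m <- /(_ i erefl)] := @wo_min (eq i); first by exists i. Qed.

Lemma wo_total i j : le i j \/ le j i.
Proof.
have [|m mE mP] := @wo_min (fun k => k = i \/ k = j); first by exists i; left.
have [mi mj] : le m i /\ le m j by split; apply: mP; [left|right].
by case: mE mi mj => -> ? ?; [left|right].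
Qed.

Lemma wo_anti i j : le i j -> le j i -> i = j.
Proof.
move=> ij ji; pose A k := `[< k = i \/ k = j >].
have [|m [_ mU]] := wo (A := A); first by exists i; apply/asboolP; left.
rewrite -(mU i) ?(mU j) //; split; do ?by apply/asboolP; auto.
  by move=> k /asboolP[] ->; rewrite ?wo_refl.
by move=> k /asboolP[] ->; rewrite ?wo_refl.
Qed.

Lemma wo_trans i j k : le i j -> le j k -> le i k.
Proof.
move=> ij jk.
have [|m mE mP] := @wo_min (fun l => [\/ l = i, l = j | l = k]).
  by exists i; constructor 1.
have [mi mj mk] : [/\ le m i, le m j & le m k].
  by split; apply: mP; [constructor 1|constructor 2|constructor 3].
case: mE mi mj mk => -> // mi mj _; first by rewrite (wo_anti ij mi).
by rewrite -(wo_anti jk mj).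
Qed.

Lemma wo_lt_le_trans i j k : lt i j -> le j k -> lt i k.
Proof.
move=> [ij nij] jk; split; first exact: wo_trans jk.
by move=> ik; apply: nij; apply: wo_anti => //; rewrite ik.
Qed.

Lemma wo_le_lt_trans i j k : le i j -> lt j k -> lt i k.
Proof.
move=> ij [jk njk]; split; first exact: wo_trans jk.
by move=> ik; apply: njk; apply: wo_anti => //; rewrite -ik.
Qed.

Lemma wo_lt_trans i j k : lt i j -> lt j k -> lt i k.
Proof. by move=> [ij _]; apply: wo_le_lt_trans. Qed.

Lemma wo_lt_or_ge i j : lt i j \/ le j i.
Proof.
have [ji|nji] := pselect (le j i); [by right|left].
by have [ij|//] := wo_total i j; split=> // ij'; apply: nji; rewrite ij' wo_refl.
Qed.

Lemma wo_lt_wf : well_founded lt.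
Proof.
move=> i; apply: contrapT => ni.
have [m nm mP] := @wo_min (fun i => ~ Acc lt i) (ex_intro _ i ni).
apply: nm; constructor=> j jm; apply: contrapT => /mP mj.
by have [] := wo_lt_le_trans jm mj.
Qed.

Lemma wo_succ i : (exists j, lt i j) -> exists j, is_succ le i j.
Proof. by move=> /wo_min[j ij jP]; exists j. Qed.

Lemma wo_fix X (F : forall i, (forall j, lt j i -> X) -> X) :
  exists C : I -> X, forall i, C i = F i (fun j _ => C j).
Proof.
exists (Fix wo_lt_wf (fun=> X) F) => i; rewrite Fix_eq // => j f g fg.
by congr F; apply: functional_extensionality_dep => k; apply/funext => ?; apply: fg.
Qed.

End WellOrder.

Lemma limit_ordinal_nat : limit_ordinal leq.
Proof.
split; last 2 first.
- by exists 0%N.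
- by move=> i; exists i.+1; split=> //; apply: n_Sn.
move=> A [n An]; have exA : exists n, n \in A by exists n.
have [m Am mP] := ex_minnP exA; exists m; split; first by split=> // k /mP.
by move=> k [kA kP]; apply/eqP; rewrite eqn_leq mP //= kP.
Qed.

Lemma is_succ_nat n m : is_succ leq n m <-> m = n.+1.
Proof.
have lt_ord k l : ord_lt leq k l <-> (k < l)%N.
  by split=> [[kl /eqP nkl]|kl]; rewrite ?ltn_neqAle ?nkl //; split;
    [exact: ltnW|move=> e; rewrite e ltnn in kl].
split=> [[/lt_ord nm mP]|->]; last by split=> [|k /lt_ord //]; apply/lt_ord.
by apply/eqP; rewrite eqn_leq nm mP //; apply/lt_ord.
Qed.

Lemma embeds_power K : embeds K (K -> Prop).
Proof. by exists eq => x y; move=> /(congr1 (fun P => P y)) ->. Qed.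

Lemma cantor K : ~ embeds (K -> Prop) K.
Proof.
move=> [f fI]; pose D k := exists P, f P = k /\ ~ P k.
have nD : ~ D (f D) by move=> DD; have [P [/fI PD nP]] := DD; apply: nP; rewrite PD.
by apply: (nD); exists D.
Qed.

(* The successor cardinal of K as an initial segment of a well-order of the
   power set of K. *)
Lemma regular_ordinal K : embeds nat K -> exists (I : Type) (le : rel I),
  [/\ limit_ordinal le, embeds I (K -> Prop) &
      forall f : K -> I, exists i, forall k, ord_lt le (f k) i].
Proof.
move=> Kinf; have [k0] : inhabited K by have [n _] := Kinf; exists; apply: (n 0%N).
pose P : eqType := {eclassic (K -> Prop)}.
have [leP wo] := well_ordering_principle P.
pose S : set P := [set x | embeds {y | ord_lt leP y x} K].
pose le : rel {x | S x} := fun x y => leP (sval x) (sval y).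
(* [S] consists of the points with at most K predecessors. *)
have S_lt x y : S y -> ord_lt leP x y -> S x.
  move=> Sy xy; apply: embeds_trans Sy.
  exists (fun z : {z | ord_lt leP z x} => exist _ (sval z) (wo_lt_trans wo (svalP z) xy)).
  by move=> z z' /(congr1 sval)/= /sval_inj.
(* If [S] is everything, Cantor applies; otherwise [S] is the set of predecessors of the first
   missing point m, and a bound by K would put m into [S]. *)
have nS : ~ embeds {x | S x} K.
  have [ST|/existsNP nST] := pselect (forall x, S x).
    move=> SK; apply: (@cantor K); apply: embeds_trans SK.
    by exists (fun x : P => exist _ x (ST x)) => x y /(congr1 sval).
  have [m nSm mP] := wo_min wo nST; move=> SK; apply: nSm; apply: embeds_trans SK.
  have Slt x : ord_lt leP x m -> S x.
    by move=> xm; apply: contrapT => /mP mx; have [] := wo_lt_le_trans wo xm mx.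
  exists (fun z : {z | ord_lt leP z m} => exist _ (sval z) (Slt _ (svalP z))).
  by move=> z z' /(congr1 sval)/= /sval_inj.
have lt_le x y : ord_lt le x y <-> ord_lt leP (sval x) (sval y).
  by split=> -[xy nxy]; split=> // e; apply: nxy; [apply: sval_inj|rewrite e].
have le_wo : well_order le.
  move=> A [a Aa].
  have [|m [Sm Am] mP] := @wo_min _ _ wo (fun x => exists Sx : S x, exist _ x Sx \in A).
    by exists (sval a); case: a Aa => x Sx; exists Sx.
  exists (exist _ m Sm); split; first split=> //.
    by move=> [x Sx] xA; apply: mP; exists Sx.
  move=> [x Sx] [xA xP]; apply: sval_inj => /=; apply: (wo_anti wo).
    by apply: mP; exists Sx.
  exact: (xP _ Am).
(* Segments up to the values of an unbounded [f] would cover [S] by K sets of size at most K. *)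
have bound (f : K -> {x | S x}) : exists i, forall k, ord_lt le (f k) i.
  apply: contrapT => nb; apply: nS.
  apply: (@embeds_cover K Kinf K _ (fun k x => le x (f k))).
  - exact: embeds_refl.
  - move=> k; apply: embeds_trans (embeds_inf_option Kinf (svalP (f k))).
    have /choice[e eP] (x : {x | le x (f k)}) :
        exists y : option {y | ord_lt leP y (sval (f k))},
          if y is Some z then sval z = sval (sval x) else sval x = f k.
      have [e|ne] := pselect (sval x = f k); first by exists None.
      have lx : ord_lt leP (sval (sval x)) (sval (f k)).
        by apply/lt_le; split=> //; apply: (svalP x).
      by exists (Some (exist (fun y => ord_lt leP y _) _ lx)).
    exists e => x y exy; apply: sval_inj; have := eP x; have := eP y; rewrite exy.
    case: (e y) => [z zy zx|-> -> //]; apply: sval_inj; by rewrite -zx.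
  - move=> i; apply: contrapT => ni; apply: nb; exists i => k.
    by have [//|ik] := wo_lt_or_ge le_wo (f k) i; case: ni; exists k.
have [x0 _] : exists x : {x | S x}, True.
  apply: contrapT => n0; apply: nS.
  by exists (fun=> k0) => x; case: n0; exists x.
exists {x | S x}, le; split=> //.
- by split=> // i; have [j /(_ k0)] := bound (fun=> i); exists j.
- by exists sval => x y /sval_inj.
Qed.

(** * Universal chains *)

Section Chains.
Variable R : nzRingType.
Implicit Types (A B E M N V W : lmodType R).

Lemma inj_linear_inverse V W (f : {linear V -> W}) : injective f ->
    (forall y, exists x, f x = y) ->
  exists g : {linear W -> V}, cancel f g /\ cancel g f.
Proof.
move=> fI /choice[g gK]; have [|h hE] := @linear_exists R W V g.
  by move=> a x y; apply: fI; rewrite linear_comb !gK.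
by exists h; split=> x; rewrite hE ?gK //; apply: fI; rewrite gK.
Qed.

Lemma module_iso_inverse M N : module_iso M N ->
  exists (f : {linear M -> N}) (g : {linear N -> M}), cancel f g /\ cancel g f.
Proof.
move=> [f [g fK gK]]; exists f.
have [||h hP] := @inj_linear_inverse M N f; last by exists h.
- exact: can_inj fK.
- by move=> y; exists (g y).
Qed.

Lemma module_isoI M N (f : {linear M -> N}) (g : {linear N -> M}) :
  cancel f g -> cancel g f -> module_iso M N.
Proof. by move=> fK gK; exists f, g. Qed.

Lemma module_iso_refl M : module_iso M M.
Proof. by have [//|f fE] := @linear_exists R M M id; exists f, id => x; rewrite fE. Qed.

Lemma module_iso_sym M N : module_iso M N -> module_iso N M.
Proof. by move=> /module_iso_inverse[f [g [fK gK]]]; apply: module_isoI gK fK. Qed.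

Lemma module_iso_trans N M V : module_iso M N -> module_iso N V -> module_iso M V.
Proof. by move=> [f fB] [g gB]; exists (g \o f); apply: bij_comp. Qed.

Lemma module_iso_injective M N : module_iso M N -> injective_module M -> injective_module N.
Proof.
move=> /module_iso_inverse[u [v [uK vK]]] Minj A B i f iI.
have [g gE] := Minj _ _ i (v \o f) iI; exists (u \o g) => x /=.
by rewrite gE /= vK.
Qed.

Lemma linear_image V W (f : {linear V -> W}) : injective f ->
  exists (S : submodClosed W) (u : {linear V -> submod S}) (v : {linear submod S -> V}),
  [/\ forall y, y \in S <-> exists x, f x = y, forall x, \val (u x) = f x, cancel u v & cancel v u].
Proof.
move=> fI.
have SS : is_submod (range f).
  split=> [|a _ _ [x _ <-] [y _ <-]]; first by exists 0; rewrite ?linear0.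
  by exists (a *: x + y); rewrite ?linear_comb.
have SE y : y \in submod_set SS <-> exists x, f x = y.
  by split=> [/asboolP[x _ <-]|[x <-]]; [exists x|apply/asboolP; exists x].
have [u uE] : exists u : {linear V -> submod (submod_set SS)}, forall x, \val (u x) = f x.
  by apply: submod_corestrict => x; apply/SE; exists x.
have [||v [uK vK]] := @inj_linear_inverse _ _ u.
- by move=> x y /(congr1 \val); rewrite !uE => /fI.
- move=> y; have /SE[x fx] := submod_valP y.
  by exists x; apply: val_inj; rewrite -fx -uE.
by exists (submod_set SS), u, v.
Qed.

Lemma in_KP T M : in_K T M <-> embeds M T /\ embeds T M.
Proof. exact: card_eqTP. Qed.

Lemma in_K_iso T M N : module_iso M N -> in_K T M -> in_K T N.
Proof.
move=> /module_iso_inverse[f [g [fK gK]]] /in_KP[MT TM]; apply/in_KP; split.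
  by apply: embeds_trans MT; exists g; apply: can_inj gK.
by apply: embeds_trans TM _; exists f; apply: can_inj fK.
Qed.

Definition universal_sub T V (A B : submodClosed V) : Prop :=
  forall N (i : {linear submod A -> N}), injective i -> embeds N T ->
    exists f : {linear N -> submod B}, injective f /\ forall x, \val (f (i x)) = \val x.

(** An extension of A is at least as large as A, which has cardinality T, so only the upper bound on
    N matters. *)
Lemma universal_overP T V (A B : submodClosed V) : universal_over T A B <->
  [/\ {subset A <= B}, in_K T (submod A), in_K T (submod B) & universal_sub T A B].
Proof.
split=> -[AB KA KB U]; split=> // N i.
  move=> iI NT; apply: U => //; apply/in_KP; split=> //.
  have /in_KP[_ TA] := KA; apply: embeds_trans TA _; by exists i.
by move=> /in_KP[NT _] iI; apply: U.
Qed.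

(* A coordinate of [option I -> G] is used up at each step of the chain, so
   that an extension of a submodule supported below i can be realised with a
   new coordinate i that detects everything outside the submodule. *)
Lemma universal_step T (I : Type) (le : rel I) (G : lmodType R) (Phi : lmodType R -> Prop) i
    (A : submodClosed (option I -> G)) :
    well_order le -> injective_module G ->
    (forall N, embeds N T -> exists f : {linear N -> G}, injective f) ->
    (forall M N, module_iso M N -> Phi M -> Phi N) ->
    (exists B (j : {linear submod A -> B}), [/\ injective j, embeds B T, univ_ext T j & Phi B]) ->
    in_K T (submod A) ->
    (forall x k, x \in A -> x (Some k) <> 0 -> ord_lt le k i) ->
  exists B : submodClosed (option I -> G), [/\ universal_over T A B, Phi (submod B) &
    forall x k, x \in B -> x (Some k) <> 0 -> le k i].
Proof.
move=> wo Ginj GP PhiI [B [j [jI BT jU PhiB]]] KA Asupp.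
pose E : lmodType R := option I -> G.
have [c cE] : exists c : {linear submod A -> E}, forall x, c x = \val x by apply: submod_incl.
have Einj : injective_module E by apply: injective_funs.
have [f [fE f0]] := extension_split c Einj jI BT GP.
(* Below [i] and at [None] the extension of the inclusion is kept; coordinate [i] carries B modulo
   A; the others are set to 0, which changes nothing on A. *)
pose g (b : B) : E := fun k => if k is Some k' then
  (if `[< ord_lt le k' i >] then (f b).1 k else if `[< k' = i >] then (f b).2 else 0)
  else (f b).1 k.
have [|h hE] := @linear_exists R B E g.
  move=> a x y; apply/funext => -[k|]; rewrite /g linear_comb //=.
  rewrite -[RHS]/(a *: (if _ then _ else _) + (if _ then _ else _)).
  by do 2 case: ifP => // _; rewrite scaler0 addr0.
have hA x : h (j x) = \val x.
  rewrite hE /g fE; apply/funext => -[k|]; rewrite /= cE //.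
  case: asboolP => // nk; have -> : \val x (Some k) = 0.
    by apply: contrapT => /(Asupp _ _ (submod_valP x)).
  by case: ifP.
have hI : injective h.
  apply: linear_inj => b; rewrite hE => gb.
  have := congr1 (fun u => u (Some i)) gb; rewrite /g.
  case: asboolP => [[]//|_]; rewrite asboolT // => fb2.
  have [x jx] := f0 b fb2; move: (hA x); rewrite jx hE gb => /esym x0.
  by rewrite -jx (_ : x = 0) ?linear0 //; apply: val_inj.
have [S [u [v [SE uE uK vK]]]] := linear_image hI.
have uvI : module_iso B (submod S) by apply: module_isoI uK vK.
have /in_KP[AT TA] := KA.
exists S; split.
- apply/universal_overP; split=> //.
  + by move=> x xA; apply/SE; exists (j (Submod xA)); rewrite hA.
  + apply: in_K_iso uvI _; apply/in_KP; split=> //.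
    by apply: embeds_trans TA _; exists j.
  + move=> N k kI NT; have [e [eI eE]] := jU N k kI NT.
    exists (u \o e); split; first by apply: inj_comp eI; apply: can_inj uK.
    by move=> x; rewrite -hA -uE /= eE.
- exact: PhiI PhiB.
- move=> _ k /SE[b <-]; rewrite hE /g; case: asboolP => [[]//|_].
  by case: asboolP => // -> _; apply: wo_refl.
Qed.

(** Turns a chain inside a larger module into a chain of submodules of its union [U]. *)
Lemma submod_restrict V (U A : submodClosed V) : {subset A <= U} ->
  exists (A' : submodClosed (submod U)) (u : {linear submod A' -> submod A})
         (v : {linear submod A -> submod A'}),
  [/\ forall x, x \in A' = (\val x \in A), forall x, \val (u x) = \val (\val x),
      cancel u v & cancel v u].
Proof.
move=> AU.
have SS : is_submod [set x : submod U | \val x \in A].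
  split=> [|a x y xA yA]; first by rewrite /= rpred0.
  by rewrite /= rpredD // rpredZ.
pose A' := submod_set SS; have A'E x : x \in A' = (\val x \in A).
  by apply/asboolP/idP.
have [|f fE] := @linear_exists R (submod A') V (fun x => \val (\val x)).
  by move=> a x y; rewrite !submod_val_linear.
have [|u uE] := submod_corestrict (f := f) (S := A).
  by move=> x; rewrite fE -A'E; apply: submod_valP.
have [||v [uK vK]] := @inj_linear_inverse _ _ u.
- by move=> x y /(congr1 \val); rewrite !uE !fE => /val_inj/val_inj.
- move=> y; have yA' : Submod (AU _ (submod_valP y)) \in A' by rewrite A'E; apply: submod_valP.
  by exists (Submod yA'); apply: val_inj; rewrite uE fE.
by exists A', u, v; split=> // x; rewrite uE fE.
Qed.

Lemma universal_over_restrict T V (U A B : submodClosed V) (A' B' : submodClosed (submod U))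
    (uA : {linear submod A' -> submod A}) (vA : {linear submod A -> submod A'})
    (uB : {linear submod B' -> submod B}) (vB : {linear submod B -> submod B'}) :
    (forall x, x \in A' = (\val x \in A)) -> (forall x, x \in B' = (\val x \in B)) ->
    (forall x, \val (uA x) = \val (\val x)) -> (forall x, \val (uB x) = \val (\val x)) ->
    cancel uA vA -> cancel vA uA -> cancel uB vB -> cancel vB uB ->
  universal_over T A B -> universal_over T A' B'.
Proof.
move=> A'E B'E uAE uBE uAK vAK uBK vBK /universal_overP[AB KA KB uAB].
apply/universal_overP; split.
- by move=> x; rewrite A'E B'E => /AB.
- by apply: in_K_iso KA; apply: module_isoI vAK uAK.
- by apply: in_K_iso KB; apply: module_isoI vBK uBK.
move=> N i iI NT; have [|f [fI fE]] := uAB N (i \o vA) _ NT.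
  by apply: inj_comp iI _; apply: can_inj vAK.
exists (vB \o f); split; first by apply: inj_comp fI; apply: can_inj vBK.
move=> x; apply: val_inj; rewrite -[RHS]uAE -[LHS]uBE /= vBK.
by rewrite -{1}[x]uAK; apply: fE.
Qed.

(** [Phi] is trivial for limit models; for superlimits it says that B is isomorphic to the
    superlimit. *)
Definition has_universal_extensions T (Phi : lmodType R -> Prop) : Prop :=
  forall A, in_K T A -> exists B (j : {linear A -> B}),
    [/\ injective j, embeds B T, univ_ext T j & Phi B].

Definition universal_union T (Phi : lmodType R -> Prop) (I : Type) (le : rel I) N
    (C : I -> submodClosed N) : Prop :=
  [/\ increasing_chain le T C, continuous_chain le C, chain_union C &
    forall i j, is_succ le i j -> universal_over T (C i) (C j) /\ Phi (submod (C j))].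

(* The chain lives in [option I -> G]: the coordinate None carries the first
   module, and C i is the union of the steps made below i, a step at j adding
   the coordinate j. *)
Theorem universal_chain T (I : Type) (le : rel I) (Phi : lmodType R -> Prop) A0 :
    embeds (LS R) T -> limit_ordinal le -> embeds I T -> in_K T A0 ->
    (forall M N, module_iso M N -> Phi M -> Phi N) ->
    has_universal_extensions T Phi ->
  exists N (C : I -> submodClosed N), universal_union T Phi le C.
Proof.
move=> LST [wo [i0 _] nomax] IT KA0 PhiI ext.
have NT := LS_nat LST.
have [G [Ginj GP]] := injective_universal R T.
pose E : lmodType R := option I -> G; pose lt := ord_lt le.
pose ok i (A B : submodClosed E) := [/\ universal_over T A B, Phi (submod B) &
  forall x k, x \in B -> x (Some k) <> 0 -> le k i].
pose below i (A : submodClosed E) :=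
  in_K T (submod A) /\ forall x k, x \in A -> x (Some k) <> 0 -> lt k i.
have /choice[next nextP] (p : I * submodClosed E) : exists B : submodClosed E,
    below p.1 p.2 -> ok p.1 p.2 B.
  have [bA|nb] := pselect (below p.1 p.2); last by exists p.2 => /nb.
  by have [B okB] := universal_step wo Ginj GP PhiI (ext _ bA.1) bA.1 bA.2; exists B.
(* The recursion must return a submodule before its value is proved to be one; other sets get a
   default. *)
have /choice[asub asubP] (S : set E) : exists A : submodClosed E,
    is_submod S -> forall x, (x \in A) = `[< S x >].
  have [SS|nS] := pselect (is_submod S); first by exists (submod_set SS).
  by exists (submod_set (span_submod (@id E))) => /nS.
have [f0 f0I] : exists f : {linear A0 -> G}, injective f by apply: GP; have /in_KP[] := KA0.
have [|fE fEE] := @linear_exists R A0 E (fun x k => if k is Some _ then 0 else f0 x).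
  move=> a x y; apply/funext => -[k|]; rewrite ?linear_comb //.
  by rewrite -[RHS]/(a *: 0 + 0) scaler0 addr0.
have fEI : injective fE.
  by move=> x y; rewrite !fEE => /(congr1 (fun u => u None))/f0I.
have [base [ub [vb [baseE ubE ubK vbK]]]] := linear_image fEI.
have base_supp x k : x \in base -> x (Some k) <> 0 -> False.
  by move=> /baseE[y <-]; rewrite fEE.
have Kbase : in_K T (submod base) by apply: in_K_iso KA0; apply: module_isoI ubK vbK.
have [C CE] := wo_fix wo (fun i (rec : forall j, lt j i -> submodClosed E) =>
  asub [set x | x \in base \/ exists j (ji : lt j i), x \in next (j, rec j ji)]).
pose Ni j := next (j, C j).
pose S i : set E := [set x | x \in base \/ exists2 j, lt j i & x \in Ni j].
have {}CE i : C i = asub (S i).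
  rewrite CE; congr asub; apply/seteqP; split=> x.
    by case=> [?|[j [ji ?]]]; [left|right; exists j].
  by case=> [?|[j ji ?]]; [left|right; exists j, ji].
have QS i : is_submod (S i) -> forall x, x \in C i <-> S i x.
  by move=> SS x; rewrite CE asubP //; split=> /asboolP.
have Q i : is_submod (S i) /\ below i (C i).
  elim/(well_founded_ind (wo_lt_wf wo)): i => i IH.
  have Cx j x : lt j i -> x \in C j <-> S j x by move=> /IH[/QS].
  have okN j : lt j i -> ok j (C j) (Ni j) by move=> /IH[_ /(nextP (j, C j))].
  have CN j x : lt j i -> x \in C j -> x \in Ni j.
    by move=> /okN[/universal_overP[CjN _ _ _] _ _]; apply: CjN.
  have bN j x : lt j i -> x \in base -> x \in Ni j.
    by move=> ji xb; apply: CN => //; apply/(Cx _ _ ji); left.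
  have NN j k x : lt j k -> lt k i -> x \in Ni j -> x \in Ni k.
    by move=> jk ki xj; apply: CN => //; apply/(Cx _ _ ki); right; exists j.
  have NN' j k x : le j k -> lt k i -> x \in Ni j -> x \in Ni k.
    have [->//|njk jk] := pselect (j = k); exact: NN.
  have SS : is_submod (S i).
    split=> [|a x y]; first by left; rewrite rpred0.
    have lin (A : submodClosed E) : x \in A -> y \in A -> a *: x + y \in A.
      by move=> xA yA; rewrite rpredD // rpredZ.
    move=> [xb|[j ji xj]] [yb|[k ki yk]].
    - by left; apply: lin.
    - by right; exists k => //; apply: lin => //; apply: bN.
    - by right; exists j => //; apply: lin => //; apply: bN.
    - have [jk|kj] := wo_total wo j k.
        by right; exists k => //; apply: lin => //; apply: NN' jk ki xj.
      by right; exists j => //; apply: lin => //; apply: NN' kj ji yk.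
  split=> //; split; last first.
    move=> x k /(QS _ SS)[/base_supp/[apply]//|[j ji xj] xk].
    by have [_ _ /(_ _ _ xj xk) kj] := okN _ ji; apply: wo_le_lt_trans kj ji.
  apply/in_KP; split; last first.
    have /in_KP[_] := Kbase; move=> /embeds_trans; apply.
    have bC (x : submod base) : \val x \in C i by apply/(QS _ SS); left; apply: submod_valP.
    by exists (fun x => Submod (bC x)) => x y /(congr1 \val) /= /val_inj.
  (* [C i] is covered by [base] and the earlier steps, at most T pieces of size T. *)
  pose cover (o : option {j | lt j i}) : set (submod (C i)) :=
    [set x | if o is Some j then \val x \in Ni (sval j) else \val x \in base].
  have sub (A : submodClosed E) : embeds (submod A) T ->
      embeds {x : submod (C i) | \val x \in A} T.
    apply: embeds_trans; exists (fun x => Submod (svalP x)) => x y /(congr1 \val) /=.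
    by move=> /val_inj/sval_inj.
  apply: (@embeds_cover T NT (option {j | lt j i}) _ cover).
  - by apply: embeds_inf_option => //; apply: embeds_trans IT; exists sval => x y /sval_inj.
  - move=> [[j ji]|]; apply: sub.
      by have [/universal_overP[_ _ /in_KP[]]] := okN _ ji.
    by have /in_KP[] := Kbase.
  - move=> x; have /(QS _ SS)[xb|[j ji xj]] := submod_valP x; first by exists None.
    by exists (Some (exist _ j ji)).
have Cx i x : x \in C i <-> S i x by have [/QS] := Q i.
have okN j : ok j (C j) (Ni j) by have [_ /(nextP (j, C j))] := Q j.
have CN j x : x \in C j -> x \in Ni j.
  by have [/universal_overP[CjN _ _ _] _ _] := okN j; apply: CjN.
have NC j k x : lt j k -> x \in Ni j -> x \in C k by move=> jk xj; apply/Cx; right; exists j.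
have CC j k x : le j k -> x \in C j -> x \in C k.
  have [->//|njk jk xj] := pselect (j = k); exact: (@NC j) (CN _ _ xj).
have CS j k : is_succ le j k -> forall x, x \in C k <-> x \in Ni j.
  move=> [jk kP] x; split=> [|xj]; last exact: NC xj.
  move=> /Cx[xb|[l lk xl]]; first by apply: CN; apply/Cx; left.
  have [<-//|nlj] := pselect (l = j).
  apply: CN; apply: NC xl; split=> //.
  have [[jl njl]|//] := wo_lt_or_ge wo j l.
  have [kl nkl] := wo_lt_le_trans wo lk (kP _ (conj jl njl)).
  by [].
have US : is_submod [set x | exists i, x \in C i].
  split=> [|a x y [j xj] [k yk]]; first by exists i0; rewrite rpred0.
  have [jk|kj] := wo_total wo j k.
    by exists k; rewrite rpredD // rpredZ // (CC _ _ _ jk).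
  by exists j; rewrite rpredD // ?rpredZ // (CC _ _ _ kj).
pose U := submod_set US.
have CU i : {subset C i <= U} by move=> x xi; apply/asboolP; exists i.
have /choice[C' C'P] i := submod_restrict (CU i).
exists (submod U), C'; split.
- split=> [i|i j ij x].
    have [u [v [_ _ uK vK]]] := C'P i; have [_ [Ki _]] := Q i.
    by apply: in_K_iso Ki; apply: module_isoI vK uK.
  have [_ [_ [-> _ _ _]]] := C'P i; have [_ [_ [-> _ _ _]]] := C'P j; exact: CC.
- move=> i [[j0 j0i] lim] x; have [_ [_ [-> _ _ _]]] := C'P i.
  have C'j j : \val x \in C j -> x \in C' j by have [_ [_ [-> _ _ _]]] := C'P j.
  move=> /Cx[xb|[j ji xj]].
    by exists j0 => //; apply: C'j; apply/Cx; left.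
  have [k jk ki] := lim j ji; exists k => //; apply: C'j; exact: NC xj.
- move=> x; have /asboolP[i xi] := submod_valP x; exists i.
  by have [_ [_ [-> _ _ _]]] := C'P i.
move=> i j ij; have [ui [vi [iE uiE uiK viK]]] := C'P i.
have [uj [vj [jE ujE ujK vjK]]] := C'P j.
have CjN : forall x, (x \in C j) = (x \in Ni i) by move=> x; apply/idP/idP=> /(CS _ _ ij).
(* [C j] and [Ni i] have the same elements but are different terms, hence the transport along [w]
   and [z]. *)
have [w [z [wK zK wE]]] : exists (w : {linear submod (C j) -> submod (Ni i)})
    (z : {linear submod (Ni i) -> submod (C j)}), [/\ cancel w z, cancel z w &
    forall x, \val (z x) = \val x].
  have [fj fjE] := submod_incl (C j); have [fn fnE] := submod_incl (Ni i).
  have [|w wE] := submod_corestrict (f := fj) (S := Ni i).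
    by move=> x; rewrite fjE -CjN; apply: submod_valP.
  have [|z zE] := submod_corestrict (f := fn) (S := C j).
    by move=> x; rewrite fnE CjN; apply: submod_valP.
  exists w, z; split=> x; do ?apply: val_inj; rewrite ?zE ?fnE ?wE ?fjE // ?zE ?fnE //.
have [uN PhiN _] := okN i; split; last first.
  by apply: PhiI PhiN; apply: module_iso_trans (module_isoI zK wK) (module_isoI vjK ujK).
apply: (universal_over_restrict iE jE uiE ujE uiK viK ujK vjK).
have /universal_overP[sub Ki KN uni] := uN; apply/universal_overP; split=> //.
- by move=> x /sub; rewrite CjN.
- by apply: in_K_iso KN; apply: module_isoI zK wK.
- move=> N k kI NT'; have [f [fI ff]] := uni N k kI NT'; exists (z \o f).
  by split=> [|x] /=; [apply: inj_comp fI; apply: can_inj zK|rewrite wE].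
Qed.

End Chains.

(** * Injectivity of unions of chains *)

Section ChainUnions.
Variable R : nzRingType.
Implicit Types (A B D E M N V W : lmodType R).

(** The pushout of A and R over the ideal: A * R modulo the pairs (y, -x) with (x, y) in [G], where
    b is the class of (0, 1). *)
Lemma adjoin_solution A (G : set (R^o * A)) : is_submod G -> functional G ->
  exists (Q : lmodType R) (i : {linear A -> Q}) (b : Q), [/\ injective i, embeds Q (A * R) &
    forall x y, G (x, y) <-> i y = x *: b].
Proof.
move=> GS Gf; pose S : set (A * R^o) := [set u | G (- u.2, u.1)].
have [|Q [p [psurj pK]]] := @quotient_exists R (A * R^o)%type S.
  split=> [|a u v Su Sv]; first by rewrite /S /= oppr0; case: GS.
  rewrite /S /= opprD -scalerN; exact: (GS.2 a _ _ Su Sv).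
have [|i iE] := @linear_exists R A Q (fun x => p (x, 0)).
  by move=> a x y; rewrite -linear_comb; congr (p (_, _)); rewrite /= scaler0 addr0.
have bE x : x *: p (0, 1) = p (0, x).
  by rewrite -linear_scale; congr (p (_, _)); rewrite /= ?scaler0 // -[LHS]/(x * 1) mulr1.
exists Q, i, (p (0, 1)); split; last 1 first.
- move=> x y; rewrite iE bE; split=> [Gxy|/eqP].
    apply/eqP; rewrite -subr_eq0 -linearB; apply/eqP/pK.
    by rewrite /S /= opprB !subr0.
  by rewrite -subr_eq0 -linearB => /eqP/pK; rewrite /S /= opprB !subr0.
- apply: linear_inj => x; rewrite iE => /pK; rewrite /S /= oppr0; exact: Gf.
- exact: embeds_surj psurj.
Qed.

Lemma chain_union_injective T (I : Type) N (C : I -> submodClosed N) :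
    embeds (LS R) T -> chain_union C ->
    (forall i, exists j, universal_over T (C i) (C j)) ->
    (forall G : set (R^o * N), is_submod G -> functional G ->
      exists i, forall x y, G (x, y) -> y \in C i) ->
  injective_module N.
Proof.
move=> LST CU Cuniv bound; apply: baer => G GS Gf.
have RT := LS_ring LST.
have NT := LS_nat LST.
have [i GC] := bound G GS Gf; have [j /universal_overP[_ KA _ uni]] := Cuniv i.
pose G' : set (R^o * submod (C i)) := [set u | G (u.1, \val u.2)].
have [||Q [k [b [kI QA Gb]]]] := @adjoin_solution _ G'.
- by split=> [|a u v Gu Gv]; [case: GS|exact: (GS.2 a _ _ Gu Gv)].
- by move=> m /Gf m0; apply: val_inj.
have [|f [fI fE]] := uni Q k kI.
  by apply: embeds_trans QA _; apply: embeds_inf_prod => //; have /in_KP[] := KA.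
exists (\val (f b)) => x y Gxy.
have /Gb kx : G' (x, Submod (GC _ _ Gxy)) by [].
by have := fE (Submod (GC _ _ Gxy)); rewrite kx linear_scale => e; apply: esym e.
Qed.

(** A left ideal has at most LS R elements, so regularity bounds the indices where their images
    appear. *)
Lemma regular_chain_bounded (I : Type) (le : rel I) T N (C : I -> submodClosed N) :
    (forall f : LS R -> I, exists i, forall k, ord_lt le (f k) i) ->
    increasing_chain le T C -> chain_union C ->
  forall G : set (R^o * N), is_submod G -> functional G ->
    exists i, forall x y, G (x, y) -> y \in C i.
Proof.
move=> reg [_ CC] CU G GS Gf.
have /choice[f fP] (k : LS R) : exists i, forall x y, k = inl x -> G (x, y) -> y \in C i.
  case: k => [x|n]; last by have [i _] := CU 0; exists i.
  have [[y Gxy]|ny] := pselect (exists y, G (x, y)).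
    by have [i yi] := CU y; exists i => x' y' [<-] /(functionalP GS Gf Gxy) <-.
  by have [i _] := CU 0; exists i => x' y [<-] Gxy; case: ny; exists y.
have [i fi] := reg f; exists i => x y Gxy.
by apply: CC (fP (inl x) x y erefl Gxy); have [] := fi (inl x).
Qed.

Lemma noetherian_graph_generated N (G : set (R^o * N)) :
    left_noetherian R -> is_submod G -> functional G ->
  exists s : seq N, forall S : set N, is_submod S -> (forall y, y \in s -> S y) ->
    forall x y, G (x, y) -> S y.
Proof.
move=> Rn GS Gf.
have [|s sE] := @noetherian_finitely_generated R [set x | exists y, G (x, y)] Rn.
  split=> [|b x x' [y Gy] [y' Gy']]; first by exists 0; case: GS.
  by exists (b *: y + y'); have := GS.2 b _ _ Gy Gy'.
have /choice[k kE] (i : 'I_(size s)) : exists y, G (s`_i, y).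
  by have := span_gen (fun i : 'I_(size s) => s`_i : R^o) i; rewrite sE.
exists (codom k) => S SS Sk x y Gxy.
have [|||y' Gxy' Sy'] := (_ : span (fun i : 'I_(size s) => s`_i : R^o) x)
    [set x | exists2 y, G (x, y) & S y].
- by rewrite sE; exists y.
- split=> [|b z z' [u Gu Su] [u' Gu' Su']]; first by exists 0; [case: GS|case: SS].
  by exists (b *: u + u'); [have := GS.2 b _ _ Gu Gu'|case: SS => _; apply].
- by move=> i; exists (k i) => //; apply: Sk; apply: codom_f.
by rewrite (functionalP GS Gf Gxy Gxy').
Qed.

Lemma noetherian_chain_bounded (I : Type) (le : rel I) T N (C : I -> submodClosed N) :
    left_noetherian R -> well_order le -> increasing_chain le T C -> chain_union C ->
  forall G : set (R^o * N), is_submod G -> functional G ->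
    exists i, forall x y, G (x, y) -> y \in C i.
Proof.
move=> Rn wo [_ CC] CU G GS Gf.
have [s sP] := noetherian_graph_generated Rn GS Gf.
have [i si] : exists i, forall y, y \in s -> y \in C i.
  elim: s {sP} => [|y s [i si]]; first by have [i _] := CU 0; exists i.
  have [j yj] := CU y; have [ij|ji] := wo_total wo i j.
    by exists j => z; rewrite inE => /orP[/eqP->//|/si]; apply: CC.
  by exists i => z; rewrite inE => /orP[/eqP->|/si//]; apply: CC yj.
by exists i => x y Gxy; apply: (sP [set y | y \in C i]) Gxy => //; apply: is_submod_closed.
Qed.

(** Meant for superlimits, whose chains need not be universal: the member containing the image
    solves the problem itself. *)
Lemma noetherian_chain_injective (I : Type) (le : rel I) T N (C : I -> submodClosed N) :
    left_noetherian R -> well_order le -> increasing_chain le T C -> chain_union C ->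
    (forall i, injective_module (submod (C i))) ->
  injective_module N.
Proof.
move=> Rn wo inc CU Cinj; apply: baer => G GS Gf.
have [i GC] := noetherian_chain_bounded Rn wo inc CU GS Gf.
pose G' : set (R^o * submod (C i)) := [set u | G (u.1, \val u.2)].
have [||g gE] := injective_graph (G := G') (Cinj i).
- by split=> [|a u v Gu Gv]; [case: GS|exact: (GS.2 a _ _ Gu Gv)].
- by move=> m /Gf m0; apply: val_inj.
exists (\val (g 1)) => x y Gxy; have := gE x (Submod (GC _ _ Gxy)) Gxy.
rewrite -[x in g x]mulr1 -[x * 1]/(x *: (1 : R^o)) linear_scale => /(congr1 \val) e.
exact: esym e.
Qed.

(* Over an ascending chain of ideals J n, the homomorphism x |-> \sum_n g n x,
   where g n has kernel J n and values in C n.+1 independent of C n, is a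
   finite sum on the union of the J n but is bounded by no C n, so it is not
   the multiplication by an element of N. *)
Lemma noetherian_of_injective_union T N (C : nat -> submodClosed N) :
    embeds (LS R) T -> increasing_chain leq T C -> chain_union C ->
    (forall n, universal_over T (C n) (C n.+1)) -> injective_module N ->
  left_noetherian R.
Proof.
move=> LST [_ CC] CU Cuniv Ninj J JS.
have RT := LS_ring LST.
have NT := LS_nat LST.
have Jle n m : (n <= m)%N -> {subset J n <= J m}.
  by move=> /subnK <-; elim: (m - n)%N => [|k IHk] x // /IHk/JS.
(* [g n] maps R onto the second summand of [C n] * (R / J n), embedded over [C n] into the next
   member. *)
have /choice[g gP] n : exists g : {linear R^o -> N}, [/\ forall x, x \in J n -> g x = 0,
    forall x, g x \in C n.+1 & forall x, g x \in C n -> x \in J n].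
  have [Q [p [psurj pK]]] := quotient_exists (is_submod_closed (J n)).
  have /universal_overP[_ KA _ uni] := Cuniv n.
  have [|i iE] := @linear_exists R (submod (C n)) (submod (C n) * Q)%type (fun x => (x, 0)).
    by move=> a x y; congr pair; rewrite /= scaler0 addr0.
  have [||f [fI fE]] := uni _ i.
  - by move=> x y; rewrite !iE => -[].
  - apply: embeds_inf_prod => //; first by have /in_KP[] := KA.
    exact: embeds_trans (embeds_surj psurj) RT.
  have [|g gE] := @linear_exists R R^o N (fun x => \val (f (0, p x))).
    move=> a x y; rewrite -submod_val_linear -linear_comb; congr (\val (f (_, _))).
      by rewrite /= scaler0 addr0.
    by rewrite linear_comb.
  exists g; split=> x.
  - by move=> xJ; rewrite gE (_ : p x = 0) ?linear0 //; apply/pK.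
  - by rewrite gE; apply: submod_valP.
  - rewrite gE => xC; have := fE (Submod xC); rewrite iE => /= /val_inj/fI[] _ /esym.
    by move=> /pK.
pose G : set (R^o * N) :=
  [set u | exists2 n, u.1 \in J n & u.2 = \sum_(i < n) g i u.1].
(* The sum is stationary because [g i] kills [J n] for i >= n. *)
have Gw n m x : x \in J n -> (n <= m)%N -> \sum_(i < m) g i x = \sum_(i < n) g i x.
  move=> xn; elim: m => [|m IHm]; first by rewrite leqn0 => /eqP->.
  rewrite leq_eqVlt => /orP[/eqP->//|]; rewrite ltnS => nm.
  by rewrite big_ord_recr /= IHm //; have [-> //] := gP m; [rewrite addr0|apply: Jle xn].
have [||h hE] := injective_graph (G := G) Ninj.
- split=> [|a [x u] [y v] [n /= xn ->] [m /= ym ->]].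
    by exists 0%N; rewrite ?rpred0 //= big_ord0.
  have xk := Jle _ _ (leq_maxl n m) _ xn; have yk := Jle _ _ (leq_maxr n m) _ ym.
  exists (maxn n m); first by rewrite rpredD // rpredZ.
  rewrite /= -(Gw _ _ _ xn (leq_maxl n m)) -(Gw _ _ _ ym (leq_maxr n m)).
  by rewrite scaler_sumr -big_split; apply: eq_bigr => i _; rewrite linear_comb.
- by move=> m [n _ /= ->]; apply: big1 => i _; rewrite linear0.
have [k hk] := CU (h 1).
exists k => m km x; apply/idP/idP; last exact: Jle.
move=> xm; apply: contraT => nxk.
(* With n.+1 the first index whose ideal contains x, every term except [g n x] lies in [C n]; hence
   [g n x] does too, and x is already in [J n]. *)
have [[|n] xn nmin] := ex_minnP (ex_intro (fun n => x \in J n) m xm).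
  by rewrite (Jle 0%N k _ x xn) in nxk.
have kn : (k <= n)%N by rewrite leqNgt; apply: contra nxk => nk; apply: Jle xn.
have : x *: h 1 = \sum_(i < n.+1) g i x.
  rewrite -linear_scale -[_ *: _]/(x * 1) mulr1; apply: hE; by exists n.+1.
rewrite big_ord_recr /= => /esym/(canRL (addKr _)) gn.
have : g n x \in C n.
  rewrite gn rpredD //; last by rewrite rpredZ // (CC _ _ kn).
  rewrite -scaleN1r rpredZ //; apply: rpred_sum => i _.
  by have [_ gi _] := gP i; apply: (CC i.+1).
by have [_ _ /[apply] /nmin] := gP n; rewrite ltnn.
Qed.

End ChainUnions.

(** * Sigma-injectivity over noetherian rings *)

Section SigmaInjective.
Variable R : nzRingType.
Implicit Types (D E F M N X : lmodType R).

Lemma injective_retract D M (s : {linear M -> D}) (r : {linear D -> M}) :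
  cancel s r -> injective_module D -> injective_module M.
Proof.
move=> sK Dinj A B i f iI; have [g gE] := Dinj _ _ i (s \o f) iI.
by exists (r \o g) => x /=; rewrite gE /= sK.
Qed.

Lemma direct_sum_finite I M (x : direct_sum I M) : finite_set [set i | \val x i <> 0].
Proof. by have /asboolP := submod_valP x. Qed.

Lemma direct_sum_exists I M (f : I -> M) : finite_set [set i | f i <> 0] ->
  exists x : direct_sum I M, \val x = f.
Proof.
move=> ff; have fin : f \in @finite_support R I M by apply/asboolP.
by exists (Submod fin).
Qed.

Lemma sigma_injective_retract M : sigma_injective M -> injective_module M.
Proof.
move=> /(_ unit); have fin (f : unit -> M) : finite_set [set i | f i <> 0] by [].
have /choice[s sE] (x : M) : exists y : direct_sum unit M, \val y = fun=> x.
  exact: direct_sum_exists.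
have [|s' s'E] := @linear_exists R M (direct_sum unit M) s.
  by move=> a x y; apply: val_inj; rewrite submod_val_linear !sE.
have [|r rE] := @linear_exists R (direct_sum unit M) M (fun x => \val x tt).
  by move=> a x y; rewrite submod_val_linear.
by apply: (@injective_retract _ _ s' r) => x; rewrite rE s'E sE.
Qed.

(** A finitely generated image has finite support, so solving coordinate by coordinate there, with 0
    elsewhere, gives an element of the direct sum. *)
Lemma noetherian_sigma_injective M :
  left_noetherian R -> injective_module M -> sigma_injective M.
Proof.
move=> Rn Minj I; apply: baer => G GS Gf.
have [s sP] := noetherian_graph_generated Rn GS Gf.
have [F Ffin sF] : exists2 F : set I, finite_set F &
    forall y, y \in s -> forall t, \val y t <> 0 -> F t.
  elim: s {sP} => [|y s [F Ffin sF]]; first by exists set0; [exact: finite_set0|].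
  exists (F `|` [set t | \val y t <> 0]).
    by rewrite finite_setU; split=> //; exact: direct_sum_finite.
  by move=> z; rewrite inE => /orP[/eqP->|zs] t zt; [right|left; apply: sF zs _ zt].
have GF x y : G (x, y) -> forall t, \val y t <> 0 -> F t.
  move=> Gxy; apply: (sP [set y : direct_sum I M | forall t, \val y t <> 0 -> F t]) Gxy => //.
  split=> [//|a u v uF vF t]; rewrite submod_val_linear => uvt.
  have [ut|ut] := pselect (\val u t = 0); last exact: uF.
  apply: vF => vt; apply: uvt.
  by rewrite -[LHS]/(a *: \val u t + \val v t) ut vt scaler0 addr0.
have /choice[m mE] t : exists m : M, forall x y, G (x, y) -> \val y t = x *: m.
  pose Gt : set (R^o * M) := [set (u.1, \val u.2 t) | u in G].
  have [||g gE] := injective_graph (G := Gt) Minj.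
  - split=> [|a _ _ [u Gu <-] [v Gv <-]]; first by exists 0 => //; case: GS.
    by exists (a *: u + v) => //; case: GS => _; apply.
  - by move=> m [[x y] Gxy [/= x0 <-]]; rewrite x0 in Gxy; rewrite (Gf _ Gxy).
  exists (g 1) => x y Gxy; rewrite -linear_scale -[_ *: _]/(x * 1) mulr1.
  by rewrite (gE x (\val y t)) //; exists (x, y).
pose f t := if `[< F t >] then m t else 0.
have [|d dE] := @direct_sum_exists I M f.
  by apply: sub_finite_set Ffin => t; rewrite /f /=; case: asboolP.
exists d => x y Gxy; apply: val_inj; apply/funext => t.
rewrite -[RHS]/(x *: \val d t) dE /f; case: asboolP => [_|nF]; first exact: mE.
by rewrite scaler0; apply: contrapT => yt; apply: nF; apply: GF Gxy _ yt.
Qed.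

End SigmaInjective.

(** * Bumby's theorem *)

Section Bumby.
Variable R : nzRingType.
Implicit Types E F : lmodType R.

(* With p a retraction of g, X = ker p and phi = g h, the sum of the phi^n X
   is direct, hence injective, and phi shifts it; absorbing X into it turns
   E = X (+) g F into a copy of F. *)
Theorem noetherian_bumby E F (h : {linear E -> F}) (g : {linear F -> E}) :
    left_noetherian R -> injective_module E -> injective_module F ->
    injective h -> injective g ->
  module_iso E F.
Proof.
move=> Rn Einj Finj hI gI.
have [//|idF idFE] := @linear_exists R F F id.
have [p pK] := Finj _ _ g idF gI; have {}pK x : p (g x) = x by rewrite pK idFE.
have KS : is_submod [set x | p x = 0].
  split=> [|a x y /= px py]; first by rewrite /= linear0.
  by rewrite linear_comb px py scaler0 addr0.
pose X := submod (submod_set KS).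
have pX (x : X) : p (\val x) = 0 by have /asboolP := submod_valP x.
have [|q1 q1E] := @linear_exists R E E (fun e => e - g (p e)).
  by move=> a x y; rewrite [p _]linear_comb [g _]linear_comb opprD addrACA -scalerBr.
have [|q0 q0E] := submod_corestrict (f := q1) (S := submod_set KS).
  by move=> x; apply/asboolP; rewrite /= q1E linearB pK subrr.
have {}q0E e : \val (q0 e) = e - g (p e) by rewrite q0E q1E.
have Xinj : injective_module X.
  have [s sE] := submod_incl (submod_set KS).
  apply: (@injective_retract R E X s q0) Einj => x; apply: val_inj.
  by rewrite q0E sE pX linear0 subr0.
have Dinj := noetherian_sigma_injective Rn Xinj (I := nat); set D := direct_sum _ _ in Dinj.
pose phi e := g (h e); pose sm N (f : nat -> X) := \sum_(n < N) iter n phi (\val (f n)).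
have phiP a x y n : iter n phi (a *: x + y) = a *: iter n phi x + iter n phi y.
  by elim: n => // n IHn; rewrite !iterS IHn /phi !linear_comb.
have phi0 n : iter n phi 0 = 0 by elim: n => // n IHn; rewrite iterS IHn /phi !linear0.
have smS N f : sm N.+1 f = \val (f 0%N) + phi (sm N (f \o S)).
  by rewrite /sm big_ord_recl /phi !linear_sum.
have smW N N' f : (forall n, (N <= n)%N -> f n = 0) -> (N <= N')%N -> sm N' f = sm N f.
  move=> f0; elim: N' => [|N' IH]; first by rewrite leqn0 => /eqP->.
  rewrite leq_eqVlt => /orP[/eqP->//|]; rewrite ltnS => NN'.
  by rewrite /sm big_ord_recr /= -/(sm N' f) IH // f0 // phi0 addr0.
have smP N a f f' : sm N (a *: f + f') = a *: sm N f + sm N f'.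
  by rewrite /sm scaler_sumr -big_split; apply: eq_bigr => n _; apply: phiP.
(* Independence: [p] kills X and inverts [g], so a vanishing sum has a vanishing tail as [h] is
   injective. *)
have sm0 N f : (forall n, (N <= n)%N -> f n = 0) -> sm N f = 0 -> forall n, f n = 0.
  elim: N f => [f f0 _ n|N IH f f0]; first exact: f0.
  rewrite smS => sf; have hs : h (sm N (f \o S)) = 0.
    by have := congr1 p sf; rewrite linearD pX pK add0r linear0.
  have s0 := inj_linear0 hI hs; have fS := IH (f \o S) (fun n => f0 n.+1) s0.
  case=> [|n]; last exact: fS.
  by apply: val_inj; move: sf; rewrite s0 /phi !linear0 addr0.
have bound (d : D) : exists N, forall n, (N <= n)%N -> \val d n = 0.
  have /finite_seqP[t tE] := direct_sum_finite d.
  exists (\max_(i <- t) i).+1 => n tn; apply: contrapT => dn.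
  have nt : n \in t by have : [set` t] n by rewrite -tE.
  by have := leq_trans tn (@leq_bigmax_seq _ t xpredT (fun i : nat => i) n nt isT); rewrite ltnn.
have /choice[b bP] := bound.
have bsm (d : D) N : (b d <= N)%N -> sm N (\val d) = sm (b d) (\val d) by apply: smW (bP d).
have [|sig sigE] := @linear_exists R D E (fun d => sm (b d) (\val d)).
  move=> a x y; pose N := maxn (b (a *: x + y)) (maxn (b x) (b y)).
  rewrite -!(bsm _ N) ?leq_max ?leqnn ?orbT //.
  by rewrite -smP; congr sm.
have sigI : injective sig.
  apply: linear_inj => d; rewrite sigE => d0; apply: val_inj; apply/funext.
  exact: sm0 (bP d) d0.
have [//|idD idDE] := @linear_exists R D D id.
have [q qK] := Dinj _ _ (h \o sig) idD (inj_comp hI sigI).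
have {}qK d : q (h (sig d)) = d by rewrite qK idDE.
have cons_ex (xd : X * D) : exists d' : D,
    \val d' = fun n => if n is m.+1 then \val xd.2 m else xd.1.
  apply: direct_sum_exists.
  apply: sub_finite_set (_ : finite_set ([set 0%N] `|` S @` [set n | \val xd.2 n <> 0])).
    by move=> [|n] xn; [left|right; exists n].
  by rewrite finite_setU; split; [exact: finite_set1|apply/finite_image/direct_sum_finite].
have /choice[cons consE] := cons_ex.
have tail_ex (d : D) : exists d' : D, \val d' = fun n => \val d n.+1.
  apply: direct_sum_exists; have [N dN] := bound d.
  apply: sub_finite_set (finite_II N) => n /= dn; rewrite ltnNge; apply/negP => Nn.
  by apply: dn; apply/dN/leqW.
have /choice[tail tailE] := tail_ex.
have sig_cons x d : sig (cons (x, d)) = \val x + phi (sig d).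
  rewrite !sigE; set N := maxn (b (cons (x, d))) (b d).
  rewrite -(bsm (cons _) N.+1) -?(bsm d N) ?leq_maxr ?(leqW (leq_maxl _ _)) //.
  by rewrite smS consE.
(* [theta] views e as ([q0 e], [p e]), prepends [q0 e] to the sequence [q (p e)] and keeps the part
   of [p e] killed by [q]. Writing it without [cons] lets linearity be inferred. *)
pose kappa : {linear E -> F} := h \o (sig \o (q \o p)).
pose theta : {linear E -> F} := (h \o (q1 \+ (g \o kappa))) \+ (p \- kappa).
have thetaE e : theta e = h (sig (cons (q0 e, q (p e)))) + (p e - h (sig (q (p e)))).
  by rewrite sig_cons q0E -q1E.
have q_theta e : q (theta e) = cons (q0 e, q (p e)).
  by rewrite thetaE linearD linearB !qK subrr addr0.
have thetaI : injective theta.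
  apply: linear_inj => e te.
  have c0 n : \val (cons (q0 e, q (p e))) n = 0.
    by rewrite -q_theta te linear0.
  have q0e : q0 e = 0 by have := c0 0%N; rewrite consE.
  have qpe : q (p e) = 0.
    apply: val_inj; apply/funext => n; have := c0 n.+1; by rewrite consE.
  have pe : p e = 0.
    have ce : cons (q0 e, q (p e)) = 0 by rewrite -q_theta te linear0.
    by move: te; rewrite thetaE ce qpe addrCA subrr addr0.
  by have := congr1 \val q0e; rewrite q0E pe linear0 subr0.
have thetaS f : exists e, theta e = f.
  pose d := q f; pose f' := h (sig (tail d)) + (f - h (sig d)).
  exists (\val (\val d 0%N) + g f').
  have pe : p (\val (\val d 0%N) + g f') = f' by rewrite linearD pX pK add0r.
  have q0e : q0 (\val (\val d 0%N) + g f') = \val d 0%N.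
    by apply: val_inj; rewrite q0E pe addrK.
  have qf' : q f' = tail d by rewrite linearD linearB !qK subrr addr0.
  rewrite thetaE q0e pe qf' (_ : cons _ = d).
    by rewrite /f' addrAC subrr add0r addrC subrK.
  by apply: val_inj; apply/funext => -[|n]; rewrite consE //= tailE.
have [v [vK Kv]] := inj_linear_inverse thetaI thetaS.
exact: module_isoI vK Kv.
Qed.

End Bumby.

(** * A cardinal T with T ^ nat > T *)

Section Koenig.

(** T is the sum of the iterated power sets of K. By Cantor no stage maps onto T, so [eta n] can
    avoid the n-th values of all sequences coded in stage n; then [eta] has no code. *)
Lemma koenig K : inhabited K -> exists T : Type, embeds K T /\ ~ embeds (nat -> T) T.
Proof.
move=> [k0]; pose P n := iter n (fun X : Type => X -> Prop) K.
pose T := {n & P n}; have PT n : embeds (P n) T.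
  by exists (existT P n) => x y e; apply: existT_injr e.
exists T; split; first exact: (PT 0%N).
move=> [g gI]; have t0 : T by exact: existT P 0%N k0.
have /choice[h hK] t : exists eta : nat -> T, forall eta', g eta' = t -> eta = eta'.
  have [[eta <-]|nt] := pselect (exists eta, g eta = t); first by exists eta => ? /gI.
  by exists (fun=> t0) => eta ?; case: nt; exists eta.
have /choice[eta etaP] n : exists t : T, forall k : P n, h (existT P n k) n <> t.
  apply: contrapT => nt; apply: (@cantor (P n)); apply: embeds_trans (PT n.+1) _.
  apply: (@embeds_surj _ _ (fun k : P n => h (existT P n k) n)) => t.
  by apply: contrapT => nk; apply: nt; exists t => k hk; apply: nk; exists k.
have [n [k gk]] : exists n (k : P n), existT P n k = g eta by case: (g eta) => n k; exists n, k.
by apply: (etaP n k); rewrite (hK _ eta).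
Qed.

End Koenig.

(** * Limit models and superlimits *)

Section LimitModels.
Variable R : nzRingType.
Implicit Types (A B E M N V W : lmodType R).

Lemma amalgamation A M N (f : {linear A -> M}) (u : {linear A -> N}) :
    injective f -> injective u ->
  exists (P : lmodType R) (p : {linear M -> P}) (q : {linear N -> P}),
    [/\ injective p, injective q, forall a, p (f a) = q (u a) & embeds P (M * N)].
Proof.
move=> fI uI; pose S : set (M * N) := [set (f a, - u a) | a in [set: A]].
have [|P [p [psurj pK]]] := @quotient_exists R (M * N)%type S.
  split=> [|b _ _ [x _ <-] [y _ <-]]; first by exists 0; rewrite // !linear0 ?oppr0.
  by exists (b *: x + y); rewrite // !linear_comb ?opprD -?scalerN.
have [|p1 p1E] := @linear_exists R M P (fun x => p (x, 0)).
  by move=> a x y; rewrite -linear_comb; congr (p (_, _)); rewrite /= scaler0 addr0.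
have [|p2 p2E] := @linear_exists R N P (fun x => p (0, x)).
  by move=> a x y; rewrite -linear_comb; congr (p (_, _)); rewrite /= scaler0 addr0.
exists P, p1, p2; split.
- apply: linear_inj => x; rewrite p1E => /pK[a _ [<- /eqP]]; rewrite oppr_eq0 => /eqP.
  by move=> /(inj_linear0 uI)->; rewrite linear0.
- apply: linear_inj => x; rewrite p2E => /pK[a _ [/(inj_linear0 fI)-> <-]].
  by rewrite linear0 oppr0.
- move=> a; rewrite p1E p2E; apply/eqP; rewrite -subr_eq0 -linearB; apply/eqP/pK.
  by exists a => //; congr pair; rewrite /= ?subr0 ?sub0r.
- exact: embeds_surj psurj.
Qed.

(** Embed [A * N] over A and restrict to N. *)
Lemma universal_over_embeds T V (A B : submodClosed V) N :
    embeds (LS R) T -> universal_over T A B -> embeds N T ->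
  exists f : {linear N -> submod B}, injective f.
Proof.
move=> LST /universal_overP[_ KA _ uni] NT.
have [|i iE] := @linear_exists R (submod A) (submod A * N)%type (fun x => (x, 0)).
  by move=> a x y; congr pair; rewrite /= scaler0 addr0.
have [||f [fI _]] := uni _ i.
- by move=> x y; rewrite !iE => -[].
- by apply: embeds_inf_prod NT; [exact: LS_nat LST|have /in_KP[] := KA].
have [|g gE] := @linear_exists R N (submod B) (fun x => f (0, x)).
  by move=> a x y; rewrite -linear_comb; congr (f (_, _)); rewrite /= scaler0 addr0.
by exists g => x y; rewrite !gE => /fI[].
Qed.

Lemma coded_universal_extensions T : embeds (LS R) T -> coded R T ->
  exists2 W : lmodType R, in_K T W & has_universal_extensions T (fun _ : lmodType R => True).
Proof.
move=> LST Tc; have [W [Winj WT TW WP]] := coded_universal_injective Tc LST.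
exists W; first exact/in_KP.
move=> A /in_KP[AT _]; have [f fI] := WP A AT.
have [|j jE] := @linear_exists R A (W * W)%type (fun x => (f x, 0)).
  by move=> a x y; rewrite linear_comb; congr pair; rewrite /= scaler0 addr0.
exists (W * W)%type, j; split=> //.
- by move=> x y; rewrite !jE => -[/fI].
- by apply: embeds_inf_prod => //; apply: LS_nat LST.
- move=> N i iI NT; have [g [gI gE]] := univ_ext_prod Winj fI WP iI NT.
  by exists g; split=> // x; rewrite gE jE.
Qed.

Lemma universal_union_limit T Phi (I : Type) (le : rel I) N (C : I -> submodClosed N) :
  limit_ordinal le -> embeds I T -> universal_union T Phi le C -> limit_model T N.
Proof.
move=> lim /cardinal_leP IT [inc cont CU uni]; exists I, le; split=> //.
by exists C; split=> // i j /uni[].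
Qed.

Lemma universal_union_nat T Phi N (C : nat -> submodClosed N) :
    embeds (LS R) T -> universal_union T Phi leq C -> injective_module N ->
  left_noetherian R.
Proof.
move=> LST [inc _ CU uni]; apply: (noetherian_of_injective_union LST inc CU) => n.
by have [] := uni n n.+1; first exact/is_succ_nat.
Qed.

Lemma limit_succ (I : Type) (le : rel I) i : limit_ordinal le -> exists j, is_succ le i j.
Proof. by move=> [wo _ nomax]; apply: wo_succ. Qed.

(** Shared by uniqueness and superlimits, which identify the two unions for different [Phi]. The
    bound on T makes room for the regular ordinal. *)
Lemma noetherian_of_unique_unions T Phi A0 :
    embeds (LS R -> Prop) T -> in_K T A0 ->
    (forall M N, module_iso M N -> Phi M -> Phi N) -> has_universal_extensions T Phi ->
    (forall (I I' : Type) (le : rel I) (le' : rel I') N N'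
      (C : I -> submodClosed N) (C' : I' -> submodClosed N'),
      limit_ordinal le -> limit_ordinal le' -> embeds I T -> embeds I' T ->
      universal_union T Phi le C -> universal_union T Phi le' C' -> module_iso N N') ->
  left_noetherian R.
Proof.
move=> PT KA0 PhiI ext uniq.
have LST : embeds (LS R) T.
  exact: embeds_trans (@embeds_power _) PT.
have [I [le [lim IP reg]]] := regular_ordinal (LS_infinite R).
have IT := embeds_trans IP PT.
have [N [C NC]] := universal_chain LST lim IT KA0 PhiI ext.
have [N' [C' NC']] := universal_chain LST limit_ordinal_nat (LS_nat LST) KA0 PhiI ext.
apply: (universal_union_nat LST NC').
apply: module_iso_injective (uniq _ _ _ _ _ _ _ _ lim limit_ordinal_nat IT (LS_nat LST) NC NC') _.
have [inc _ CU uni] := NC.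
apply: (chain_union_injective LST CU); last exact: regular_chain_bounded reg inc CU.
by move=> i; have [j /uni[]] := limit_succ i lim; exists j.
Qed.

Lemma chain_union_card T (I : Type) (le : rel I) N (C : I -> submodClosed N) :
    embeds nat T -> embeds I T -> increasing_chain le T C -> chain_union C ->
  in_K T N.
Proof.
move=> NT IT [CK _] CU; apply/in_KP; split.
  apply: (@embeds_cover T NT I N (fun i => [set x | x \in C i])) => // i.
  have /in_KP[+ _] := CK i; apply: embeds_trans.
  by exists (fun x => Submod (svalP x)) => x y /(congr1 \val)/= /sval_inj.
have [i _] := CU 0; have /in_KP[_ TC] := CK i; apply: embeds_trans TC _.
by exists \val; apply: val_inj.
Qed.

Lemma noetherian_injective_unique T M N :
    left_noetherian R -> injective_module M -> injective_module N ->
    in_K T M -> in_K T N ->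
    (forall A, embeds A T -> exists f : {linear A -> M}, injective f) ->
    (forall A, embeds A T -> exists f : {linear A -> N}, injective f) ->
  module_iso M N.
Proof.
move=> Rn Minj Ninj /in_KP[MT _] /in_KP[NT _] MU NU.
by have [f fI] := NU M MT; have [g gI] := MU N NT; apply: noetherian_bumby fI gI.
Qed.

Lemma noetherian_limit_model T M : left_noetherian R -> embeds (LS R) T -> limit_model T M ->
  [/\ injective_module M, in_K T M &
    forall A, embeds A T -> exists f : {linear A -> M}, injective f].
Proof.
move=> Rn LST [I [le [lim /cardinal_leP IT [C [inc _ uni CU]]]]].
have [wo [i0 _] _] := lim.
have uni' i : exists j, universal_over T (C i) (C j).
  by have [j ij] := limit_succ i lim; exists j; apply: uni.
split.
- by apply: (chain_union_injective LST CU uni'); apply: noetherian_chain_bounded wo inc CU.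
- exact: chain_union_card (LS_nat LST) IT inc CU.
- move=> A AT; have [j /universal_over_embeds] := uni' i0.
  move=> /(_ A LST AT)[f fI]; have [g gE] := submod_incl (C j).
  by exists (g \o f) => x y /=; rewrite !gE => /val_inj/fI.
Qed.

Lemma noetherian_uniqueness T : left_noetherian R -> embeds (LS R) T ->
  uniqueness_of_limit_models R T.
Proof.
move=> Rn LST; split.
  have [W KW ext] := coded_universal_extensions LST (coded_noetherian Rn LST).
  have [N [C NC]] := universal_chain LST limit_ordinal_nat (LS_nat LST) KW (fun _ _ _ _ => I) ext.
  by exists N; apply: universal_union_limit limit_ordinal_nat (LS_nat LST) NC.
move=> M N /(noetherian_limit_model Rn LST)[Minj KM MU].
move=> /(noetherian_limit_model Rn LST)[Ninj KN NU].
exact: noetherian_injective_unique Minj Ninj KM KN MU NU.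
Qed.

(** A embeds in some [C j]; an extension N of A is amalgamated with [C j] over A, and the next
    member absorbs the result. *)
Lemma limit_model_universal_extensions T M : embeds (LS R) T -> limit_model T M ->
  exists2 A0 : lmodType R, in_K T A0 & has_universal_extensions T (fun _ : lmodType R => True).
Proof.
move=> LST [I [le [lim _ [C [[CK _] _ uni _]]]]].
have [_ [i _] _] := lim; exists (submod (C i)) => // A /in_KP[AT _].
have [j /uni ij] := limit_succ i lim; have [k /uni jk] := limit_succ j lim.
have [f fI] := universal_over_embeds LST ij AT.
have /universal_overP[Cjk Kj Kk univ] := jk.
have [cj cjE] := submod_incl (C j).
have [|e eE] := submod_corestrict (f := cj) (S := C k).
  by move=> x; rewrite cjE; apply/Cjk/submod_valP.
have eI : injective e.
  by move=> x y /(congr1 \val); rewrite !eE !cjE => /val_inj.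
exists (submod (C k)), (e \o f); split=> //; first exact: inj_comp.
  by have /in_KP[] := Kk.
move=> N u uI NT; have [P [p [q [pI qI pq PMN]]]] := amalgamation fI uI.
have [|g [gI gE]] := univ P p pI.
  by apply: embeds_trans PMN _; apply: embeds_inf_prod => //; [exact: LS_nat LST|have /in_KP[] := Kj].
exists (g \o q); split=> [|x]; first exact: inj_comp.
by apply: val_inj; rewrite /= -pq gE eE cjE.
Qed.

Lemma noetherian_of_uniqueness T : embeds (LS R -> Prop) T ->
  uniqueness_of_limit_models R T -> left_noetherian R.
Proof.
move=> PT [[M limM] uniq].
have LST : embeds (LS R) T.
  exact: embeds_trans (@embeds_power _) PT.
have [A0 KA0 ext] := limit_model_universal_extensions LST limM.
apply: (noetherian_of_unique_unions PT KA0 _ ext) => //.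
move=> I I' le le' N N' C C' lim lim' IT IT' NC NC'.
by apply: uniq; [apply: universal_union_limit lim IT NC|apply: universal_union_limit lim' IT' NC'].
Qed.

Lemma noetherian_superlimit T : left_noetherian R -> embeds (LS R) T ->
  exists M, superlimit T M.
Proof.
move=> Rn LST; have Tc := coded_noetherian Rn LST.
have [W [Winj WT TW WP]] := coded_universal_injective Tc LST.
have NT := LS_nat LST; have KW : in_K T W by apply/in_KP.
exists W; split=> // [N /in_KP[NT' _]|I le N C wo /cardinal_leP IT inc CW CU].
  (* The extra summand makes the embedding proper: the image of (0, 1) is missed. *)
  have [|f fI] := WP (N * R^o)%type.
    by apply: embeds_inf_prod => //; apply: LS_ring LST.
  have [|g gE] := @linear_exists R N W (fun x => f (x, 0)).
    by move=> a x y; rewrite -linear_comb; congr (f (_, _)); rewrite /= scaler0 addr0.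
  exists g; split=> [x y|gT]; first by rewrite !gE => /fI[].
  have : range g (f (0, 1)) by rewrite gT.
  by move=> [x _]; rewrite gE => /fI[_ /esym/eqP]; rewrite oner_eq0.
have KN := chain_union_card NT IT inc CU.
have Ninj : injective_module N.
  apply: (noetherian_chain_injective Rn wo inc CU) => i.
  exact: module_iso_injective (module_iso_sym (CW i)) Winj.
apply: (noetherian_injective_unique Rn Ninj Winj KN KW) => // A /WP[f fI].
have [i _] := CU 0; have [u [v [uK vK]]] := module_iso_inverse (CW i).
have [c cE] := submod_incl (C i).
exists (c \o (v \o f)) => x y /=; rewrite !cE => /val_inj/(can_inj vK).
exact: fI.
Qed.

(** Only successor members are known to be isomorphic to M, so the chain of successors, with the
    same union, is used. *)
Lemma superlimit_union T M (I : Type) (le : rel I) N (C : I -> submodClosed N) :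
    limit_ordinal le -> embeds I T -> superlimit T M ->
    universal_union T (fun B => module_iso B M) le C ->
  module_iso N M.
Proof.
move=> lim /cardinal_leP IT [_ _ SM] [[CK CC] _ CU uni]; have [wo _ _] := lim.
have /choice[s sP] i := limit_succ i lim.
apply: (SM I le N (C \o s)) => //.
- split=> [i|i j ij] /=; first exact: CK.
  apply: CC; have [[jsj nj] _] := sP j; apply: (sP i).2.
  exact: (wo_le_lt_trans wo ij (conj jsj nj)).
- by move=> i; have [] := uni _ _ (sP i).
- by move=> x; have [i xi] := CU x; exists i; apply: CC xi; have [[]] := sP i.
Qed.

(** A universal extension of A embeds in M, which makes M universal over A; all successor members
    can thus be copies of M. *)
Lemma noetherian_of_superlimit M : superlimit (LS R -> Prop) M -> left_noetherian R.
Proof.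
set T := LS R -> Prop => SM; have [KM Mprop _] := SM.
have LST : embeds (LS R) T by exact: embeds_power.
have [W _ ext] := coded_universal_extensions LST (coded_power R).
apply: (@noetherian_of_unique_unions T (fun B => module_iso B M) M) => //.
- exact: embeds_refl.
- by move=> N N' /module_iso_sym NN'; apply: module_iso_trans NN'.
- move=> A KA; have [A' [j [jI A'T jU _]]] := ext A KA.
  have [|f [fI _]] := Mprop A'.
    apply/in_KP; split=> //; have /in_KP[_ TA] := KA.
    by apply: embeds_trans TA _; exists j.
  exists M, (f \o j); split; [exact: inj_comp|by have /in_KP[] := KM| |].
    move=> N i iI NT; have [g [gI gE]] := jU N i iI NT.
    by exists (f \o g); split=> [|x] /=; [exact: inj_comp|rewrite gE].
  exact: module_iso_refl.
move=> I I' le le' N N' C C' lim lim' IT IT' NC NC'.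
apply: module_iso_trans (superlimit_union lim IT SM NC) _.
exact/module_iso_sym/(superlimit_union lim' IT' SM NC').
Qed.

Lemma noetherian_of_sigma_injective :
  (forall M, is_limit_model M -> sigma_injective M) -> left_noetherian R.
Proof.
move=> sig; pose T := LS R -> Prop.
have LST : embeds (LS R) T by exact: embeds_power.
have [W KW ext] := coded_universal_extensions LST (coded_power R).
have [N [C NC]] := universal_chain LST limit_ordinal_nat (LS_nat LST) KW (fun _ _ _ _ => I) ext.
apply: (universal_union_nat LST NC); apply/sigma_injective_retract/sig.
exists T; split; first exact/cardinal_leP.
exact: universal_union_limit limit_ordinal_nat (LS_nat LST) NC.
Qed.

End LimitModels.

(** * Galois types *)

Section Stability.
Variable R : nzRingType.
Implicit Types (A M N : lmodType R).

(** The homomorphism x |-> x b from the ideal of the x with x b in M. *)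
Definition type_graph M (p : pretype M) : set (R^o * M) :=
  [set u | u.1 *: pt_elt p = pt_emb p u.2].

Lemma type_graph_submod M (p : pretype M) : is_submod (type_graph p).
Proof.
split=> [|a u v /= pu pv]; first by rewrite /type_graph /= scale0r linear0.
by rewrite /type_graph /= scalerDl -[a *: u.1]/(a * u.1) -scalerA pu pv linear_comb.
Qed.

Lemma type_graph_functional M (p : pretype M) : functional (type_graph p).
Proof.
by move=> m; rewrite /type_graph /= scale0r => /esym/(inj_linear0 (@pt_emb_inj _ _ p)).
Qed.

Lemma E_at_type_graph M (p q : pretype M) : E_at p q -> type_graph p = type_graph q.
Proof.
move=> [N [f [g [fI gI fg fgb]]]]; apply/seteqP; split=> -[x m]; rewrite /type_graph /= => e.
  by apply: gI; rewrite linear_scale -fgb -linear_scale e fg.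
by apply: fI; rewrite linear_scale fgb -linear_scale e fg.
Qed.

(** Equal graphs make R b + M and R b' + M isomorphic over M. [A] is the graph of this isomorphism,
    and the two extensions are amalgamated over it. *)
Lemma type_graph_E_at M (p q : pretype M) : type_graph p = type_graph q -> E_at p q.
Proof.
move=> epq; pose S : set (pt_mod p * pt_mod q) :=
  [set (u.1 *: pt_elt p + pt_emb p u.2, u.1 *: pt_elt q + pt_emb q u.2) | u in [set: R * M]].
have SS : is_submod S.
  split=> [|a _ _ [u _ <-] [v _ <-]].
    by exists (0, 0) => //=; rewrite !scale0r !linear0 !addr0.
  exists (a * u.1 + v.1, a *: u.2 + v.2) => //=; congr pair => /=;
  by rewrite linear_comb scalerDl -scalerA addrACA -scalerDr.
pose A := submod (submod_set SS).
have [//|f fE] := @linear_exists R A (pt_mod p) (fun x => (\val x).1).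
have [//|g gE] := @linear_exists R A (pt_mod q) (fun x => (\val x).2).
have graph0 x m : x *: pt_elt p + pt_emb p m = 0 <-> x *: pt_elt q + pt_emb q m = 0.
  have sol r : x *: pt_elt r + pt_emb r m = 0 <-> type_graph r (x, - m).
    rewrite /type_graph /= linearN; split=> /eqP; first by rewrite addr_eq0 => /eqP.
    by rewrite -addr_eq0 => /eqP.
  by rewrite !sol epq.
have fI : injective f.
  apply: linear_inj => x; rewrite fE; have /asboolP[u _ ux] := submod_valP x.
  rewrite -ux /= => u0; apply: val_inj; rewrite -ux u0; congr pair.
  exact/graph0.
have gI : injective g.
  apply: linear_inj => x; rewrite gE; have /asboolP[u _ ux] := submod_valP x.
  rewrite -ux /= => u0; apply: val_inj; rewrite -ux u0; congr pair.
  exact/graph0.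
have [P [i [j [iI jI ij _]]]] := amalgamation fI gI.
have inA x m : (x *: pt_elt p + pt_emb p m, x *: pt_elt q + pt_emb q m) \in submod_set SS.
  by apply/asboolP; exists (x, m).
have ijA x m : i (x *: pt_elt p + pt_emb p m) = j (x *: pt_elt q + pt_emb q m).
  by have := ij (Submod (inA x m)); rewrite fE gE.
exists P, i, j; split=> // [x|].
  by have := ijA 0 x; rewrite !scale0r !add0r.
by have := ijA 1 0; rewrite !scale1r !linear0 !addr0.
Qed.

Lemma gtp_type_graph M (p q : pretype M) : gtp p q <-> type_graph p = type_graph q.
Proof.
split=> [|/type_graph_E_at pq]; last exact: t_step.
by elim=> [p' q' /E_at_type_graph//|p' r q' _ -> _ ->].
Qed.

Lemma coded_stable T : embeds (LS R) T -> coded R T -> stable R T.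
Proof.
move=> LST [Op [Ar [dom [[c cI] domP]]]] M /in_KP[[e eI] _].
(* A graph is coded by generators of its domain and values at them. *)
have /choice[x xP] (G : set (R^o * M)) : exists x : {a & Ar a -> M}, is_submod G ->
    span (dom (projT1 x)) = [set r | exists m, G (r, m)] /\
    forall i, G (dom (projT1 x) i, projT2 x i).
  have [GS|nG] := pselect (is_submod G); last first.
    have [a _] : exists a, span (dom a) = [set 0].
      by apply: domP; split=> // a u v /= -> ->; rewrite scaler0 addr0.
    by exists (existT _ a (fun=> 0)) => /nG.
  have [|a aP] := domP [set r | exists m, G (r, m)].
    split=> [|b u v [m Gm] [n Gn]]; first by exists 0; case: GS.
    by exists (b *: m + n); exact: (GS.2 b _ _ Gm Gn).
  have /choice[k kP] i : exists m, G (dom a i, m) by have := span_gen (dom a) i; rewrite aP.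
  by exists (existT _ a k).
have sub G G' : is_submod G -> functional G -> is_submod G' -> x G = x G' -> G `<=` G'.
  move=> GS Gf GS' xG [r m] Grm; have [dG kG] := xP G GS; have [_ kG'] := xP G' GS'.
  have [|||n Gn Gn'] := (_ : span (dom (projT1 (x G))) r)
      [set r | exists2 m, G (r, m) & G' (r, m)].
  - by rewrite dG; exists m.
  - split=> [|b u v [s Gs Gs'] [t Gt Gt']]; first by exists 0; [case: GS|case: GS'].
    by exists (b *: s + t); [exact: (GS.2 b _ _ Gs Gt)|exact: (GS'.2 b _ _ Gs' Gt')].
  - by move=> i; exists (projT2 (x G) i) => //; by move: kG'; rewrite -xG.
  by rewrite (functionalP GS Gf Grm Gn).
pose code (y : {a & Ar a -> M}) : T := c (existT _ (projT1 y) (e \o projT2 y)).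
have codeI : injective code.
  move=> [a k] [a' k'] /cI e'; have ea : a = a' := congr1 (@projT1 _ _) e'.
  case: _ / ea k' e' => k' ek; congr existT; apply/funext => i; apply: eI.
  exact: (congr1 (fun f => f i) (existT_injr ek)).
pose pt (t : gS M) := sval (cid (svalP t)).
have ptP (t : gS M) : sval t = gtp (pt t) by rewrite /pt; case: cid.
exists (fun t => code (x (type_graph (pt t)))) => t t' /codeI xtt'.
apply: sval_inj; rewrite !ptP; apply/funext => r; apply/propext.
have gg : type_graph (pt t) = type_graph (pt t').
  by apply/seteqP; split; apply: sub => //;
    do ?[exact: type_graph_submod|exact: type_graph_functional].
by split=> /gtp_type_graph e'; apply/gtp_type_graph; rewrite -e' gg.
Qed.

(* Over an ascending chain of ideals J n, choosing for each n one of T many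
   independent copies of R / J n gives T^nat distinct homomorphisms from the
   union of the J n to a module of cardinality T, hence T^nat distinct types. *)
Lemma stable_noetherian T : embeds (LS R) T -> stable R T -> ~ embeds (nat -> T) T ->
  left_noetherian R.
Proof.
move=> LST Tst nT J JS; apply: contrapT => nJ.
have Jle n m : (n <= m)%N -> {subset J n <= J m}.
  by move=> /subnK <-; elim: (m - n)%N => [|k IHk] x // /IHk/JS.
have {nJ} Jup n : exists m x, x \in J m /\ x \notin J n.
  apply: contrapT => nx; apply: nJ; exists n => m nm x; apply/idP/idP; last exact: Jle.
  by move=> xm; apply: contraT => xn; case: nx; exists m, x.
have NT := LS_nat LST; have RT := LS_ring LST.
have [t0] : inhabited T by have [i _] := NT; exists; apply: (i 0%N).
have [G [Ginj GP]] := injective_universal R T.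
have /choice[g gP] n : exists g : G, forall s, s *: g = 0 <-> s \in J n.
  have [Q [p [psurj pK]]] := quotient_exists (is_submod_closed (J n)).
  have [|f fI] := GP Q; first by apply: embeds_trans (embeds_surj psurj) RT.
  exists (f (p 1)) => s; rewrite -!linear_scale -[s *: 1]/(s * 1) mulr1 -[X in _ <-> X]pK.
  by split=> [/(inj_linear0 fI)|->] //; rewrite linear0.
pose E : lmodType R := nat * T -> G.
pose X (nl : nat * T) : E := fun kl => if `[< kl = nl >] then g nl.1 else 0.
(* With no operations, W is the span of the [X nl], of size at most T. *)
have [|||W [XW WT _]] := @op_closure R T False (fun=> False) E _ X (fun _ _ => 0) LST.
- by apply: embeds_inf_prod => //; apply: embeds_refl.
- by exists; exact: (0%N, t0).
- by exists (fun x : {a : False & False -> T} => False_rect T (projT1 x)) => -[].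
have KW : in_K T (submod W).
  (* If [g 0] vanished, [J 0] would contain 1 and the chain could not ascend. *)
  apply/in_KP; split=> //; have g0 : g 0%N <> 0.
    move=> g0; have /(gP 0%N 1) J1 : 1 *: g 0%N = 0 by rewrite g0 scaler0.
    have [m [x [_]]] := Jup 0%N; rewrite -[x]mulr1 -[x * 1]/(x *: (1 : R^o)).
    by rewrite rpredZ.
  exists (fun t => Submod (XW (0%N, t))) => t u /(congr1 (fun y => \val y (0%N, t))) /=.
  by rewrite /X asboolT //=; case: asboolP => [[]|] //.
(* An x in [J n] kills [g k] for k >= n, so the value has finite support and lies in W. *)
pose val_at (eta : nat -> T) (x : R) : E :=
  fun kl => if `[< kl.2 = eta kl.1 >] then x *: g kl.1 else 0.
pose H (eta : nat -> T) : set (R^o * submod W) :=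
  [set u | (exists n, u.1 \in J n) /\ \val u.2 = val_at eta u.1].
have val_atP eta a x y : val_at eta (a *: (x : R^o) + y) = a *: val_at eta x + val_at eta y.
  apply/funext => kl; rewrite /val_at.
  rewrite -[RHS]/(a *: (if _ then _ else _) + (if _ then _ else _)).
  by case: ifP => _; rewrite ?scaler0 ?addr0 // scalerDl -scalerA.
have HS eta : is_submod (H eta).
  split=> [|a [x u] [y v] [/= [n xn] xu] [/= [m ym] yv]].
    split; first by exists 0%N; rewrite /= rpred0.
    by apply/funext => kl; rewrite /val_at /= scale0r; case: ifP.
  split; last by rewrite submod_val_linear /= xu yv val_atP.
  have xk := Jle _ _ (leq_maxl n m) _ xn; have yk := Jle _ _ (leq_maxr n m) _ ym.
  by exists (maxn n m); rewrite /= rpredD // rpredZ.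
have Hf eta : functional (H eta).
  move=> y [_ /= y0]; apply: val_inj; apply: etrans y0 _; apply/funext => kl.
  by rewrite /val_at scale0r; case: ifP.
have Hex eta n x : x \in J n -> exists y, H eta (x, y).
  move=> xn; suff [y yE] : exists y : submod W, \val y = val_at eta x.
    by exists y; split=> //; exists n.
  have [y yE] : exists y : submod W,
      \val y = fun kl => if (kl.1 < n)%N then val_at eta x kl else 0.
    elim: {xn}n => [|n [y yE]]; first by exists 0; apply/funext.
    pose w : submod W := Submod (XW (n, eta n)).
    exists ((x : R) *: w + y); rewrite submod_val_linear yE; apply/funext => -[k l].
    rewrite -[LHS]/(x *: X (n, eta n) (k, l) + (if (k < n)%N then val_at eta x (k, l) else 0)).
    rewrite /X /val_at /= [(k < n.+1)%N]ltnS [(k <= n)%N]leq_eqVlt; have [->|nkn] := eqVneq k n.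
      rewrite ltnn addr0 /=; case: asboolP => [[->]|nl]; first by rewrite asboolT.
      by rewrite asboolF ?scaler0 // => ln; apply: nl; rewrite ln.
    by rewrite asboolF ?scaler0 ?add0r // => -[kn]; rewrite kn eqxx in nkn.
  exists y; rewrite yE; apply/funext => kl; case: ltnP => // nk.
  rewrite /val_at; case: ifP => // _; apply/esym/gP; exact: Jle nk _ xn.
have /choice[p pP] eta : exists p : pretype (submod W), type_graph p = H eta.
  have [Q [i [b [iI _ ib]]]] := adjoin_solution (HS eta) (Hf eta).
  exists (Pretype iI b); apply/seteqP; split=> -[x y]; rewrite /type_graph /=.
    by move=> /esym/ib.
  by move=> /ib.
have [F FI] := Tst _ KW; apply: nT.
exists (fun eta => F (exist _ (gtp (p eta)) (ex_intro _ (p eta) erefl))) => eta eta' /FI e.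
have /gtp_type_graph : gtp (p eta) (p eta').
  have -> : gtp (p eta) = gtp (p eta') by have := congr1 sval e.
  exact/gtp_type_graph.
(* An x outside [J n] does not kill [g n], so its image reveals [eta n]. *)
rewrite !pP => eH; apply/funext => n; have [m [x [xm xn]]] := Jup n.
have [y Hy] := Hex eta m x xm; have [_ /= yE] := Hy.
have [_ /= yE'] : H eta' (x, y) by rewrite -eH.
have := congr1 (fun f => f (n, eta n)) yE'; rewrite yE /val_at /= asboolT //.
by case: asboolP => // _ /gP xn'; rewrite xn' in xn.
Qed.

End Stability.

Theorem theorem3p12 (R : nzRingType) :
  [<-> left_noetherian R;
       superstable R;
       forall L : cardinal, cardinal_le (LS R) L ->
         exists X : cardinal,
           cardinal_le L X /\ uniqueness_of_limit_models R X;
       forall L : cardinal, cardinal_le (LS R) L ->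
         uniqueness_of_limit_models R L;
       forall L : cardinal, cardinal_succ_le (LS R) L ->
         exists M : lmodType R, superlimit L M;
       forall L : cardinal, cardinal_le (LS R) L -> stable R L;
       forall M : lmodType R, is_limit_model M -> sigma_injective M].
Proof.
(* The implications out of (3), (4), (5) and (6) in the cycle all factor through (1). *)
have uniq_noeth : (forall L : cardinal, cardinal_le (LS R) L -> exists X : cardinal,
    cardinal_le L X /\ uniqueness_of_limit_models R X) -> left_noetherian R.
  move=> uniq; have [|X [/cardinal_leP LX uX]] := uniq (LS R -> Prop).
    exact/cardinal_leP/embeds_power.
  exact: noetherian_of_uniqueness LX uX.
have limit_noeth : (forall L : cardinal, cardinal_succ_le (LS R) L ->
    exists M : lmodType R, superlimit L M) -> left_noetherian R.
  move=> SL; have [|M SM] := SL (LS R -> Prop); last exact: noetherian_of_superlimit SM.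
  by split=> [|/cardinal_leP/cantor//]; apply/cardinal_leP/embeds_power.
tfae.
- move=> Rn; exists (LS R) => L /cardinal_leP; exact: noetherian_uniqueness.
- move=> [mu muP] L _; exists (L + mu)%type; split.
    by apply/cardinal_leP; exists inl => x y [].
  by apply: muP; apply/cardinal_leP; exists inr => x y [].
- by move=> /uniq_noeth Rn L /cardinal_leP; apply: noetherian_uniqueness.
- move=> uniq L [/cardinal_leP LSL _]; apply: noetherian_superlimit LSL.
  apply: uniq_noeth => X LSX; exists X; split; last exact: uniq.
  exact/cardinal_leP/embeds_refl.
- by move=> /limit_noeth Rn L /cardinal_leP LSL; apply/coded_stable/coded_noetherian.
- move=> st; have [T [LST nT]] := koenig (inhabits (inr 0%N : LS R)).
  have Rn : left_noetherian R by apply: (stable_noetherian LST) nT; apply/st/cardinal_leP.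
  move=> M [L [/cardinal_leP LSL /(noetherian_limit_model Rn LSL)[Minj _ _]]].
  exact: noetherian_sigma_injective.
- exact: noetherian_of_sigma_injective.
Qed.
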